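(* The variety of complex $3$-dimensional derived commutative associative algebras has dimension $12$ and it has exactly $2$ irreducible components, namely $$\mathcal{C}_1=\overline{\mathcal{O}(\mathrm{J}_{07})}\quad\text{and}\quad \mathcal{C}_2=\overline{\mathcal{O}(\mathrm{A}_{01}^{\alpha,\beta,\gamma})},$$ where $\mathrm{J}_{07}$ is the commutative algebra with $e_1e_1=e_1$, $e_2e_2=e_2$, $e_3e_3=e_3$, and $\mathrm{A}_{01}^{\alpha,\beta,\gamma}$ ($\alpha,\beta,\gamma\in\mathbb{C}$) is the family of commutative algebras with $e_1e_1=e_1$, $e_2e_2=e_2$, $e_1e_3=\alpha e_2$, $e_2e_3=\beta e_1$, $e_3e_3=e_1+\gamma e_2$. In particular, there is exactly $1$ rigid algebra (up to isomorphism) in this variety.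
   Context: Let $\mathbb{V}$ be a $3$-dimensional complex vector space with fixed basis $e_1,e_2,e_3$. Algebra structures on $\mathbb{V}$ (bilinear multiplications) are identified with points of the affine space $\mathrm{Hom}(\mathbb{V}\otimes\mathbb{V},\mathbb{V})\cong\mathbb{C}^{27}$ via structure constants. The variety of complex $3$-dimensional algebras of a class defined by polynomial identities is the Zariski-closed subset $\mathbb{L}$ of structures satisfying these identities (including the zero structure). Here the class is that of derived commutative associative algebras: commutative algebras $\mathrm{A}$ such that $\mathrm{A}^2$ (the span of all products) is a commutative associative algebra. The group $\mathrm{GL}(\mathbb{V})$ acts on $\mathbb{L}$ by $(g*\mu)(x\otimes y)=g\mu(g^{-1}x\otimes g^{-1}y)$; $\mathcal{O}(\mathrm{A})$ is the orbit of a structure representing $\mathrm{A}$, and the bar is Zariski closure. For a parametrized family, the closure of $\mathcal{O}$ of the family denotes the Zariski closure of the union of the orbits of all members of the family. An algebra is rigid in $\mathbb{L}$ if its orbit is an open subset of $\mathbb{L}$. In multiplication tables, products of basis elements that are zero or follow by commutativity are omitted. *)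

(* Defs.v *)
From mathcomp Require Import all_boot all_order all_algebra.
From mathcomp Require Import classical_sets reals.
From mathcomp Require Import complex mpoly.

Set Implicit Arguments.
Unset Strict Implicit.
Unset Printing Implicit Defensive.

Import GRing.Theory.
Local Open Scope classical_set_scope.
Local Open Scope ring_scope.

(* The Zariski topology on the affine space 'M[F]_(m, n) of dimension m * n,  *)
(* with the matrix entries as coordinates.                                    *)
Section Zariski.
Variables (F : fieldType) (m n : nat).
Implicit Types X Y Z U : set 'M[F]_(m, n).

Definition zariski_closed X : Prop :=
  exists S : set {mpoly F[m * n]},
    X = [set a | forall p, S p -> p.@[fun k => mxvec a 0 k] = 0].

Definition zariski_closure X : set 'M[F]_(m, n) :=
  [set a | forall Y, zariski_closed Y -> X `<=` Y -> Y a].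

Definition closed_in X Z : Prop :=
  exists Y, zariski_closed Y /\ Z = X `&` Y.

Definition open_in X U : Prop :=
  exists Y, zariski_closed Y /\ U = X `\` Y.

Definition irreducible Z : Prop :=
  Z !=set0 /\
  forall Y1 Y2, zariski_closed Y1 -> zariski_closed Y2 ->
    Z `<=` Y1 `|` Y2 -> Z `<=` Y1 \/ Z `<=` Y2.

Definition irreducible_component X Z : Prop :=
  [/\ irreducible Z, Z `<=` X &
      forall Z', irreducible Z' -> Z' `<=` X -> Z `<=` Z' -> Z' = Z].

(* The values of c beyond d are irrelevant. *)
Definition irreducible_chain X (d : nat) (c : nat -> set 'M[F]_(m, n)) : Prop :=
  (forall i, (i <= d)%N -> closed_in X (c i) /\ irreducible (c i)) /\
  (forall i, (i < d)%N -> c i `<` c i.+1).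

(* Dimension of X as a topological space (Krull dimension).                   *)
Definition has_dimension X (d : nat) : Prop :=
  (exists c, irreducible_chain X d c) /\
  (forall k c, irreducible_chain X k c -> (k <= d)%N).

End Zariski.

(* A point mu of Hom(V (x) V, V), V = F^3, is a 9 x 3 matrix acting on row    *)
(* vectors from the right: x (x) y is the row vector mxvec (x^T *m y), and    *)
(* the row of index mxvec_index i j of mu is the product e_i e_j, so that the *)
(* entries of mu are the 27 structure constants.                              *)
Section Algebras.
Variable F : fieldType.

Definition structure := 'M[F]_(3 * 3, 3).
Implicit Types (mu nu : structure) (x y z u : 'rV[F]_3) (g : 'M[F]_3).

Definition mul mu x y : 'rV[F]_3 := mxvec (x^T *m y) *m mu.

(* Membership in A^2, the linear span of all products.                        *)
Definition in_square mu u : Prop :=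
  exists (k : nat) (c : 'I_k -> F) (x y : 'I_k -> 'rV[F]_3),
    u = \sum_(i < k) c i *: mul mu (x i) (y i).

Definition derived_comm_assoc : set structure :=
  [set mu | (forall x y, mul mu x y = mul mu y x) /\
            (forall x y z, in_square mu x -> in_square mu y -> in_square mu z ->
               mul mu (mul mu x y) z = mul mu x (mul mu y z))].

(* g in GL(V) sends x to x *m g; the first factor is the matrix of            *)
(* x (x) y |-> g^-1 x (x) g^-1 y. See mul_act.                                *)
Definition act g mu : structure :=
  lin_mx (mulmx (invmx g)^T \o mulmxr (invmx g)) *m mu *m g.

Lemma mul_act g mu x y :
  mul (act g mu) x y = mul mu (x *m invmx g) (y *m invmx g) *m g.
Proof.
by rewrite /mul /act -!mulmxA [LHS]mulmxA mul_vec_lin /= trmx_mul !mulmxA.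
Qed.

Definition orbit mu : set structure :=
  [set act g mu | g in [set g | g \in unitmx]].

Definition isomorphic mu nu : Prop :=
  exists g, g \in unitmx /\
    forall x y, mul mu x y *m g = mul nu (x *m g) (y *m g).

Definition rigid_in (L : set structure) mu : Prop := open_in L (orbit mu).

Definition e1 : 'rV[F]_3 := delta_mx 0 0.
Definition e2 : 'rV[F]_3 := delta_mx 0 1.
Definition e3 : 'rV[F]_3 := delta_mx 0 ord_max.

(* The structure with e_i e_j = t i j for i, j in {1, 2, 3}; indices of type  *)
(* 'I_3 start at 0, whence the shift.                                         *)
Definition of_table (t : nat -> nat -> 'rV[F]_3) : structure :=
  \sum_(i < 3) \sum_(j < 3) (mxvec (delta_mx i j))^T *m t i.+1 j.+1.

Lemma mul_of_table (t : nat -> nat -> 'rV[F]_3) (i j : 'I_3) :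
  mul (of_table t) (delta_mx 0 i) (delta_mx 0 j) = t i.+1 j.+1.
Proof.
have E i' j' : mxvec (delta_mx i j : 'M[F]_3) *m
    (mxvec (delta_mx i' j' : 'M[F]_3))^T = ((i' == i) && (j' == j))%:R%:M.
  rewrite [LHS]mx11_scalar mxvec_delta -rowE !mxE mxvecE mxE.
  by rewrite (eq_sym i) (eq_sym j).
rewrite /mul /of_table trmx_delta mul_delta_mx mulmx_sumr.
rewrite (bigD1 i) //= mulmx_sumr (bigD1 j) //= mulmxA E !eqxx mul1mx.
rewrite !big1 ?addr0 // => [i' ne_i | j' ne_j].
  rewrite mulmx_sumr big1 // => j' _.
  by rewrite mulmxA E (negPf ne_i) mul_scalar_mx scale0r.
by rewrite mulmxA E (negPf ne_j) andbF mul_scalar_mx scale0r.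
Qed.

Definition J07 : structure :=
  of_table (fun i j => match i, j with
    | 1%N, 1%N => e1
    | 2%N, 2%N => e2
    | 3%N, 3%N => e3
    | _, _ => 0
    end).

Definition A01 (alpha beta gamma : F) : structure :=
  of_table (fun i j => match i, j with
    | 1%N, 1%N => e1
    | 2%N, 2%N => e2
    | 1%N, 3%N | 3%N, 1%N => alpha *: e2
    | 2%N, 3%N | 3%N, 2%N => beta *: e1
    | 3%N, 3%N => e1 + gamma *: e2
    | _, _ => 0
    end).

Definition C1 : set structure := zariski_closure (orbit J07).

Definition C2 : set structure :=
  zariski_closure
    [set mu | exists alpha beta gamma, orbit (A01 alpha beta gamma) mu].

End Algebras.

(* Main.v *)
From mathcomp Require Import all_boot all_order all_algebra.
From mathcomp Require Import boolp classical_sets reals.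
From mathcomp Require Import complex mpoly ring.
Require Import Defs.

Set Implicit Arguments.
Unset Strict Implicit.
Unset Printing Implicit Defensive.

Import Order.TTheory GRing.Theory Num.Theory.
Local Open Scope classical_set_scope.
Local Open Scope ring_scope.

(* Let A be a derived commutative associative algebra. If A^2 = A, then A is  *)
(* commutative associative and unital, and is either generated by one element *)
(* (determined by the roots of a cubic) or a degenerate split algebra; moving *)
(* the roots apart shows that A lies in C1. Otherwise A^2 lies in a plane W   *)
(* on which the product is associative; W is generated by one element or has  *)
(* zero product, and moving the roots of a quadratic apart deforms W to C^2,  *)
(* which puts A in C2. Closures of images of polynomial maps are irreducible  *)
(* because any two points are joined by a rational curve. A chain of length k *)
(* of irreducible closed sets produces (N+1)^k independent functions of       *)
(* degree O(N) on its top; both components are parametrized by 12             *)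
(* coordinates, which leaves room for O(N^12) of them only, so k <= 12. The   *)
(* orbit of J07 is cut out in the variety by the nonvanishing of the          *)
(* discriminant of the trace form and of some det L_y, while the ratio of two *)
(* trace discriminants is a nonconstant invariant on C2, which therefore has  *)
(* no dense orbit.                                                            *)

(** * Regular functions and the Zariski topology *)

(** The case split on [A^2] is carried by [C1_of_square_full] (through [unit_of_square_full] and
    [unital_classification]) and [C2_of_square_proper] (through [C2_plane]). Together they give
    [derived_comm_assocU], which writes the variety as [C1] union [C2]. Every limit argument is an
    instance of [curve_closed]: a polynomial curve that lies in a closed set for all but finitely
    many parameters lies in it for all parameters.

    Both closures are irreducible by [family_irreducible]. Neither contains the other: every algebra
    in [C1] is associative while some [A01] is not, and [J07] has an invertible multiplication
    operator while no algebra in [C2] has one. This yields [irreducible_components].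

    The dimension is at most 12 by [chain_bound], since nine matrix entries and three parameters
    describe a dense part of each component. It is at least 12 by the explicit chain [chain_stage].

    The orbit of [J07] is open by [orbit_J07E]. Any other open orbit would either meet it inside
    [C1], and so coincide with it, or be dense in [C2], which [orbit_not_dense_C2] forbids. This
    gives [rigid_isomorphic]. *)

Section Regular.
Variable F : fieldType.

(** The algebra of functions generated by [X]. Working with functions on any type [T], rather than
    with [mpoly], lets regularity of determinants, products and actions be proved by closure rules,
    for the affine space, the line and the parameter spaces alike. *)
Inductive regular (T : Type) (X : set (T -> F)) : (T -> F) -> Prop :=
| regular_gen f of X f : regular X f
| regular_const c : regular X (fun=> c)
| regularD f g of regular X f & regular X g : regular X (fun t => f t + g t)
| regularM f g of regular X f & regular X g : regular X (fun t => f t * g t).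

Section Closure.
Variables (T : Type) (X : set (T -> F)).
Implicit Types f g : T -> F.

Lemma eq_regular f g : f =1 g -> regular X f -> regular X g.
Proof. by move=> /funext ->. Qed.

Lemma regularZ a f : regular X f -> regular X (fun t => a * f t).
Proof. by move=> rf; apply: regularM => //; apply: regular_const. Qed.

Lemma regularN f : regular X f -> regular X (fun t => - f t).
Proof.
by move=> /(regularZ (-1)); apply: eq_regular => t; rewrite mulN1r.
Qed.

Lemma regularB f g :
  regular X f -> regular X g -> regular X (fun t => f t - g t).
Proof. by move=> rf rg; apply: regularD => //; apply: regularN. Qed.

Lemma regular_sum I (r : seq I) (P : pred I) (f : I -> T -> F) :
  (forall i, regular X (f i)) -> regular X (fun t => \sum_(i <- r | P i) f i t).
Proof.
move=> rf; elim: r => [|i r IHr].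
  by apply: eq_regular (regular_const X 0) => t; rewrite big_nil.
case Pi: (P i).
  by apply: eq_regular (regularD (rf i) IHr) => t; rewrite big_cons Pi.
by apply: eq_regular IHr => t; rewrite big_cons Pi.
Qed.

Lemma regular_prod I (r : seq I) (P : pred I) (f : I -> T -> F) :
  (forall i, regular X (f i)) -> regular X (fun t => \prod_(i <- r | P i) f i
    t).
Proof.
move=> rf; elim: r => [|i r IHr].
  by apply: eq_regular (regular_const X 1) => t; rewrite big_nil.
case Pi: (P i).
  by apply: eq_regular (regularM (rf i) IHr) => t; rewrite big_cons Pi.
by apply: eq_regular IHr => t; rewrite big_cons Pi.
Qed.

Lemma regularX f n : regular X f -> regular X (fun t => f t ^+ n).
Proof.
move=> rf; apply: eq_regular (regular_prod (index_enum 'I_n) predT (fun=> rf)).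
by move=> t; rewrite prodr_const card_ord.
Qed.

Definition regular_mx m n (A : T -> 'M[F]_(m, n)) :=
  forall i j, regular X (fun t => A t i j).

Lemma regular_mx_const m n (A : 'M[F]_(m, n)) : regular_mx (fun=> A).
Proof. by move=> i j; apply: regular_const. Qed.

Lemma regular_mulmx m n p (A : T -> 'M[F]_(m, n)) (B : T -> 'M[F]_(n, p)) :
  regular_mx A -> regular_mx B -> regular_mx (fun t => A t *m B t).
Proof.
move=> rA rB i j.
apply: (@eq_regular (fun t => \sum_k A t i k * B t k j)) => [t|].
  by rewrite mxE.
by apply: regular_sum => k; apply: regularM.
Qed.

Lemma regular_addmx m n (A B : T -> 'M[F]_(m, n)) :
  regular_mx A -> regular_mx B -> regular_mx (fun t => A t + B t).
Proof.
move=> rA rB i j; apply: (@eq_regular (fun t => A t i j + B t i j)) => [t|].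
  by rewrite mxE.
exact: regularD.
Qed.

Lemma regular_summx I (r : seq I) (P : pred I) m n (A : I -> T -> 'M[F]_(m,
  n)) :
  (forall i, regular_mx (A i)) ->
  regular_mx (fun t => \sum_(i <- r | P i) A i t).
Proof.
move=> rA i j.
apply: (@eq_regular (fun t => \sum_(k <- r | P k) A k t i j)) => [t|].
  by rewrite summxE.
by apply: regular_sum => k; apply: rA.
Qed.

Lemma regular_scalemx m n f (A : T -> 'M[F]_(m, n)) :
  regular X f -> regular_mx A -> regular_mx (fun t => f t *: A t).
Proof.
move=> rf rA i j; apply: (@eq_regular (fun t => f t * A t i j)) => [t|].
  by rewrite mxE.
exact: regularM.
Qed.

Lemma regular_trmx m n (A : T -> 'M[F]_(m, n)) :
  regular_mx A -> regular_mx (fun t => (A t)^T).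
Proof.
by move=> rA i j; apply: eq_regular (rA j i) => t; rewrite mxE.
Qed.

Lemma regular_mxvec m n (A : T -> 'M[F]_(m, n)) :
  regular_mx A -> regular_mx (fun t => mxvec (A t)).
Proof.
move=> rA i j; rewrite ord1; case/mxvec_indexP: j => i' j'.
by apply: eq_regular (rA i' j') => t; rewrite mxvecE.
Qed.

Lemma regular_vec_mx m n (A : T -> 'rV[F]_(m * n)) :
  regular_mx A -> regular_mx (fun t => vec_mx (A t)).
Proof.
by move=> rA i j; apply: eq_regular (rA 0 (mxvec_index i j)) => t; rewrite mxE.
Qed.

Lemma regular_det n (A : T -> 'M[F]_n) :
  regular_mx A -> regular X (fun t => \det (A t)).
Proof.
move=> rA; apply: regular_sum => s; apply: regularZ.
by apply: regular_prod => i; apply: rA.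
Qed.

Lemma regular_trace n (A : T -> 'M[F]_n) :
  regular_mx A -> regular X (fun t => \tr (A t)).
Proof. by move=> rA; apply: regular_sum => i; apply: rA. Qed.

Lemma regular_adj n (A : T -> 'M[F]_n) :
  regular_mx A -> regular_mx (fun t => \adj (A t)).
Proof.
move=> rA i j.
apply: (@eq_regular (fun t => cofactor (A t) j i)) => [t|]; first by rewrite
  mxE.
apply: regularZ; apply: regular_det => i' j'.
by apply: eq_regular (rA (lift j i') (lift i j')) => t; rewrite !mxE.
Qed.

End Closure.

Lemma regular_comp S T (X : set (S -> F)) (Y : set (T -> F)) (phi : S -> T) f :
  (forall g, Y g -> regular X (g \o phi)) -> regular Y f ->
  regular X (f \o phi).
Proof.
move=> rX; elim=> {f} [f /rX //|c|f g _ rf _ rg|f g _ rf _ rg].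
- exact: regular_const.
- exact: (regularD rf rg).
- exact: (regularM rf rg).
Qed.

Definition mx_coords m n : set ('M[F]_(m, n) -> F) :=
  
  [set f | exists i j, f = fun a : 'M[F]_(m, n) => a i j].

Definition line_coord : set (F -> F) := [set id].

Lemma regular_id_mx m n : regular_mx (@mx_coords m n) id.
Proof. by move=> i j; apply: regular_gen; exists i, j. Qed.

Lemma regular_mx_comp S (X : set (S -> F)) m n (phi : S -> 'M[F]_(m, n)) f :
  regular_mx X phi -> regular (@mx_coords m n) f -> regular X (f \o phi).
Proof. by move=> rphi; apply: regular_comp => _ [i [j ->]]; apply: rphi. Qed.

Lemma regular_meval T (X : set (T -> F)) n (v : T -> 'I_n -> F) (p : {mpoly
  F[n]}) :
  (forall i, regular X (fun t => v t i)) -> regular X (fun t => p.@[v t]).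
Proof.
move=> rv; apply: (@eq_regular _ _
    (fun t => \sum_(m <- msupp p) p@_m * \prod_i v t i ^+ m i)) => [t|].
  by rewrite mevalE.
apply: regular_sum => m; apply: regularZ; apply: regular_prod => i.
exact: regularX.
Qed.

(** The way back from closure rules to polynomials, needed for closed sets and for degree counts. *)
Lemma regular_mpoly T (X : set (T -> F)) n (v : T -> 'I_n -> F) f :
  (forall g, X g -> exists i, g = fun t => v t i) -> regular X f ->
  exists p : {mpoly F[n]}, forall t, f t = p.@[v t].
Proof.
move=> Xv; elim=> {f} [g /Xv [i ->]|c|f g _ [p fE] _ [q gE]|f g _ [p fE] _ [q
  gE]].
- by exists 'X_i => t; rewrite mevalXU.
- by exists c%:MP => t; rewrite mevalC.
- by exists (p + q) => t; rewrite mevalD fE gE.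
- by exists (p * q) => t; rewrite mevalM fE gE.
Qed.

Lemma regular_poly f :
  regular line_coord f -> exists p : {poly F}, forall t, f t = p.[t].
Proof.
elim=> {f} [g ->|c|f g _ [p fE] _ [q gE]|f g _ [p fE] _ [q gE]].
- by exists 'X => t; rewrite hornerX.
- by exists c%:P => t; rewrite hornerC.
- by exists (p + q) => t; rewrite hornerD fE gE.
- by exists (p * q) => t; rewrite hornerM fE gE.
Qed.

Lemma regular_line m n (a b : 'M[F]_(m, n)) :
  regular_mx line_coord (fun t => a + t *: (b - a)).
Proof.
apply: regular_addmx; first exact: regular_mx_const.
apply: regular_scalemx; last exact: regular_mx_const.
exact: regular_gen.
Qed.

End Regular.

Section ZariskiTopology.
Variables (F : fieldType) (m n : nat).
Implicit Types X Y Z U : set 'M[F]_(m, n).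
Local Notation M := 'M[F]_(m, n).
Local Notation coords := (@mx_coords F m n).

Lemma zariski_closedP X : zariski_closed X <->
  exists S : set (M -> F), (forall f, S f -> regular coords f) /\
    X = [set a | forall f, S f -> f a = 0].
Proof.
split=> [[S ->]|[S [rS ->]]].
  exists [set f | exists p, S p /\ f = fun a : M => p.@[fun k => mxvec a 0 k]].
  split=> [_ [p [_ ->]]|].
    apply: regular_meval => k.
    exact: (regular_mxvec (@regular_id_mx F m n)).
  apply/seteqP; split=> a /= Ha.
    by move=> _ [p [Sp ->]]; apply: Ha.
  by move=> p Sp; apply: (Ha (fun a => p.@[fun k => mxvec a 0 k])); exists p.
exists [set p | S (fun a : M => p.@[fun k => mxvec a 0 k])].
apply/seteqP; split=> a /= Ha; first by move=> p /Ha.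
move=> f Sf; have [|p fE] :=
  @regular_mpoly _ _ _ _ (fun (a : M) k => mxvec a 0 k) _ _ (rS _ Sf).
  move=> _ [i [j ->]]; exists (mxvec_index i j).
  by apply/funext => b; rewrite mxvecE.
by rewrite fE; apply: Ha; rewrite -(funext fE).
Qed.

Lemma closed_family I (f : I -> M -> F) :
  (forall i, regular coords (f i)) -> zariski_closed [set a | forall i, f i a
    = 0].
Proof.
move=> rf; apply/zariski_closedP; exists [set g | exists i, g = f i].
split=> [_ [i ->] //|]; apply/seteqP; split=> a /= Ha.
  by move=> _ [i ->].
by move=> i; apply: Ha; exists i.
Qed.

Lemma closed_hypersurface f :
  regular coords f -> zariski_closed [set a : M | f a = 0].
Proof.
move=> rf; rewrite (_ : mkset _ = [set a | forall i : unit, f a = 0]).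
  exact: closed_family.
by apply/seteqP; split=> a /= => [fa _|/(_ tt)].
Qed.

Lemma closedI X Y : zariski_closed X -> zariski_closed Y -> zariski_closed (X
  `&` Y).
Proof.
move=> [S ->] [S' ->]; exists (S `|` S'); apply/seteqP; split=> a /=.
  by move=> [Sa S'a] p [/Sa|/S'a].
by move=> Ha; split=> p Sp; apply: Ha; [left|right].
Qed.

Lemma closedU X Y : zariski_closed X -> zariski_closed Y -> zariski_closed (X
  `|` Y).
Proof.
move=> [S ->] [S' ->].
exists [set pq | exists p q, [/\ S p, S' q & pq = p * q]].
apply/seteqP; split=> a /=.
  move=> [Sa|S'a] _ [p [q [Sp S'q ->]]]; rewrite mevalM.
    by rewrite (Sa p) ?mul0r.
  by rewrite (S'a q) ?mulr0.
move=> Ha; apply: contrapT => /not_orP [].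
move=> /existsNP [p /not_implyP [Sp /eqP pa]].
move=> /existsNP [q /not_implyP [Sq /eqP qa]].
have /eqP: (p * q).@[fun k => mxvec a 0 k] = 0 by apply: Ha; exists p, q.
by rewrite mevalM mulf_eq0 (negPf pa) (negPf qa).
Qed.

Lemma closed_preimage X (phi : M -> M) :
  regular_mx coords phi -> zariski_closed X -> zariski_closed (phi @^-1` X).
Proof.
move=> rphi /zariski_closedP [S [rS ->]]; apply/zariski_closedP.
exists [set g | exists f, S f /\ g = f \o phi]; split=> [_ [f [/rS rf ->]]|].
  exact: regular_mx_comp rf.
apply/seteqP; split=> a /= Ha; first by move=> _ [f [/Ha fa ->]].
by move=> f Sf; apply: (Ha (f \o phi)); exists f.
Qed.

Lemma sub_closure X : X `<=` zariski_closure X.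
Proof. by move=> a Xa Y _; apply. Qed.

Lemma closure_min X Y : zariski_closed Y -> X `<=` Y -> zariski_closure X `<=`
  Y.
Proof. by move=> cY XY a; apply. Qed.

Lemma closure_closed X : zariski_closed (zariski_closure X).
Proof.
exists [set p | forall x : M, X x -> p.@[fun k => mxvec x 0 k] = 0].
apply/seteqP; split=> a /=.
  move=> Xa p pX; apply: (Xa [set a | p.@[fun k => mxvec a 0 k] = 0]) => //.
  by exists [set p]; apply/seteqP; split=> b /= => [pb _ -> //|]; apply.
by move=> Ha _ [S ->] XS /= p Sp; apply: Ha => x /XS; apply.
Qed.

Lemma closureS X Y : X `<=` Y -> zariski_closure X `<=` zariski_closure Y.
Proof.
move=> XY; apply: closure_min; first exact: closure_closed.
by move=> a /XY; apply: sub_closure.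
Qed.

Lemma closed_sep X a : zariski_closed X -> ~ X a ->
  exists f, [/\ regular coords f, forall x, X x -> f x = 0 & f a != 0].
Proof.
move=> /zariski_closedP [S [rS ->]] /existsNP [f /not_implyP [Sf /eqP fa]].
by exists f; split=> // [|x]; [apply: rS|apply].
Qed.

(** Any two points of [X] lie on a polynomial curve that may leave [X] only at the zeros of [q]. *)
Definition linked X := forall a b, X a -> X b ->
  exists (gamma : F -> M) (q : {poly F}), [/\ regular_mx (@line_coord F) gamma,
    q != 0, forall t, q.[t] != 0 -> X (gamma t), gamma 0 = a & gamma 1 = b].

End ZariskiTopology.

Lemma poly_nonroot (F : numFieldType) (p : {poly F}) :
  p != 0 -> exists t, p.[t] != 0.
Proof.
move=> p0; apply: contrapT => /forallNP roots.
(* In characteristic zero these are [size p] distinct elements, more than [p] can have roots. *)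
pose s := [seq i%:R : F | i <- iota 0 (size p)].
suff: (size s < size p)%N by rewrite size_map size_iota ltnn.
apply: max_poly_roots => //.
  apply/allP => x _; apply/rootP/eqP/negPn/negP; exact: roots.
rewrite map_inj_in_uniq ?iota_uniq // => i j _ _ /eqP.
by rewrite eqr_nat => /eqP.
Qed.

(** * Polynomial curves, limits and irreducibility *)

Section Curves.
Variables (F : numFieldType) (m n : nat).
Implicit Types X Y Z : set 'M[F]_(m, n).

(** If [gamma t] were outside [Y], an equation of [Y] pulled back to the line would be a nonzero
    polynomial. At a common non-root of it and [q] the curve would be both inside and outside
    [Y]. *)
Lemma curve_closed Y (gamma : F -> 'M[F]_(m, n)) (q : {poly F}) :
  zariski_closed Y -> regular_mx (@line_coord F) gamma -> q != 0 ->
  (forall t, q.[t] != 0 -> Y (gamma t)) -> forall t, Y (gamma t).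
Proof.
move=> cY rg q0 qY t; apply: contrapT => /(closed_sep cY) [f [rf fY fa]].
have [p pE] := regular_poly (regular_mx_comp rg rf).
have p0 : p != 0.
  by apply: contraNneq fa => p0; rewrite -[f _]/((f \o gamma) t) pE p0 horner0.
have [s] := poly_nonroot (mulf_neq0 p0 q0).
by rewrite hornerM mulf_eq0 negb_or -pE => /andP[+ /qY /fY fs] => /=; rewrite
  fs eqxx.
Qed.

(** Suppose [Y1] misses [a] and [Y2] misses [b]. Equations separating these points restrict to
    nonzero polynomials on a curve from [a] to [b], so a generic point of that curve is in [X] but
    in neither set. *)
Lemma linked_irreducible X : X !=set0 -> linked X -> irreducible
  (zariski_closure X).
Proof.
move=> [x Xx] lX; split; first by exists x; apply: sub_closure.
move=> Y1 Y2 cY1 cY2 XY; apply: contrapT => /not_orP [].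
have notsub Y : zariski_closed Y -> ~ zariski_closure X `<=` Y ->
    exists a, X a /\ ~ Y a.
  move=> cY nXY; apply: contrapT => /forallNP XY'; apply: nXY.
  apply: closure_min => // a Xa; apply: contrapT => Ya; exact: (XY' a).
move=> /(notsub _ cY1) [a [Xa Y1a]] /(notsub _ cY2) [b [Xb Y2b]].
have [f [rf fY fa]] := closed_sep cY1 Y1a.
have [g [rg gY gb]] := closed_sep cY2 Y2b.
have [gamma [q [rgamma q0 qX g0 g1]]] := lX _ _ Xa Xb.
have [p1 p1E] := regular_poly (regular_mx_comp rgamma rf).
have [p2 p2E] := regular_poly (regular_mx_comp rgamma rg).
have p1_0 : p1 != 0.
  by apply: contraNneq fa => p0; rewrite -g0 -[f _]/((f \o gamma) 0) p1E p0
    horner0.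
have p2_0 : p2 != 0.
  by apply: contraNneq gb => p0; rewrite -g1 -[g _]/((g \o gamma) 1) p2E p0
    horner0.
have [s] := poly_nonroot (mulf_neq0 (mulf_neq0 p1_0 p2_0) q0).
rewrite !hornerM !mulf_eq0 !negb_or -p1E -p2E => /andP[/andP[fs gs] /qX Xs].
have [/fY /eqP|/gY /eqP] := XY _ (sub_closure Xs).
  by rewrite (negPf fs).
by rewrite (negPf gs).
Qed.

(** The segment between two parameters meets [d = 0] in finitely many points only, and its image
    links their values. *)
Lemma image_irreducible N (d : 'rV[F]_N -> F) (psi : 'rV[F]_N -> 'M[F]_(m, n)) :
  regular (@mx_coords F 1 N) d -> regular_mx (@mx_coords F 1 N) psi ->
  (exists v, d v != 0) ->
  irreducible (zariski_closure (psi @` [set v | d v != 0])).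
Proof.
move=> rd rpsi [v0 dv0]; apply: linked_irreducible.
  by exists (psi v0), v0.
move=> _ _ [v dv <-] [w dw <-].
have rl := regular_line v w.
have [q qE] := regular_poly (regular_mx_comp rl rd).
exists (psi \o (fun t => v + t *: (w - v))), q; split.
- by move=> i j; exact: (regular_mx_comp rl (rpsi i j)).
- apply: contraNneq dv => q0.
  by have := qE 0; rewrite q0 horner0 /= scale0r addr0 => ->.
- by move=> t qt; exists (v + t *: (w - v)); rewrite // /= -qE in qt *.
- by rewrite /= scale0r addr0.
- by rewrite /= scale1r addrC subrK.
Qed.

End Curves.

(** * Upper bound on the length of chains *)

Section DegreeBounds.
Variable F : fieldType.

(** [msize] is the degree plus one, and 0 for the zero polynomial, so bounds of the form
    [msize p <= a.+1] mean degree at most [a] without a special case. *)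
Lemma msizeM_deg n (p q : {mpoly F[n]}) a b :
  (msize p <= a.+1)%N -> (msize q <= b.+1)%N -> (msize (p * q) <= (a + b).+1)%N.
Proof.
have [->|p0] := eqVneq p 0; first by rewrite mul0r msize0.
have [->|q0] := eqVneq q 0; first by rewrite mulr0 msize0.
move=> pa qb; rewrite msizeM //.
by rewrite -subn1 leq_subLR add1n -addSn -addnS leq_add.
Qed.

Lemma msize_prod_deg n I (r : seq I) (p : I -> {mpoly F[n]}) (d : I -> nat) :
  (forall i, (msize (p i) <= (d i).+1)%N) ->
  (msize (\prod_(i <- r) p i) <= (\sum_(i <- r) d i).+1)%N.
Proof.
move=> pd; elim: r => [|i r IHr]; first by rewrite !big_nil msize1.
by rewrite !big_cons msizeM_deg.
Qed.

Lemma msizeX_deg n (p : {mpoly F[n]}) d k :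
  (msize p <= d.+1)%N -> (msize (p ^+ k) <= (d * k).+1)%N.
Proof.
move=> pd; elim: k => [|k IHk]; first by rewrite expr0 msize1 muln0.
by rewrite exprS mulnS msizeM_deg.
Qed.

Lemma msize_sum_deg n I (r : seq I) (p : I -> {mpoly F[n]}) d :
  (forall i, (msize (p i) <= d)%N) -> (msize (\sum_(i <- r) p i) <= d)%N.
Proof.
move=> pd; elim/big_ind: _ => // [|q q' qd q'd]; first by rewrite msize0.
by apply: leq_trans (msizeD_le _ _) _; rewrite geq_max qd.
Qed.

Lemma msize_comp_deg n k (p : {mpoly F[n]}) (lq : n.-tuple {mpoly F[k]}) b d :
  (msize p <= b.+1)%N -> (forall i, (msize (tnth lq i) <= d.+1)%N) ->
  (msize (p \mPo lq) <= (d * b).+1)%N.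
Proof.
move=> pb lqd; rewrite (comp_mpolywE _ pb); apply: msize_sum_deg => m.
apply: leq_trans (msizeZ_le _ _) _.
apply: leq_trans (msize_prod_deg _ (fun i => msizeX_deg (m i) (lqd i))) _.
by rewrite ltnS -big_distrr /= leq_mul2l -mdegE -ltnS bmdeg orbT.
Qed.

(** A crude count, each exponent being below [b]; only the order of growth matters later. *)
Lemma card_bmultinom n b : (#|{: 'X_{1..n < b}}| <= b ^ n)%N.
Proof.
have lt_b (m : 'X_{1..n < b}) i : (m i < b)%N.
  by apply: leq_ltn_trans (bmdeg m); rewrite mdegE (bigD1 i) //= leq_addr.
pose f (m : 'X_{1..n < b}) := [ffun i => Ordinal (lt_b m i)].
have f_inj : injective f.
  move=> m1 m2 /ffunP f12; apply/val_inj/mnmP => i.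
  by have := f12 i; rewrite !ffunE => -[].
by have := leq_card _ f_inj; rewrite card_ffun !card_ord.
Qed.

(** The coefficient matrix has more rows than columns, hence a nonzero left kernel. *)
Lemma linear_relation n b (I : finType) (e : I -> {mpoly F[n]}) :
  (forall i, (msize (e i) <= b)%N) -> (b ^ n < #|I|)%N ->
  exists a : I -> F, (exists i, a i != 0) /\ \sum_i a i *: e i = 0.
Proof.
move=> eb ltbI; pose J : finType := 'X_{1..n < b}.
pose A := \matrix_(i < #|I|, j < #|J|) (e (enum_val i))@_(enum_val j).
have : kermx A != 0.
  rewrite kermx_eq0 -row_leq_rank -ltnNge.
  apply: leq_ltn_trans (rank_leq_col _) _.
  exact: leq_ltn_trans (card_bmultinom n b) ltbI.
case/rowV0Pn => v /sub_kermxP vA /rV0Pn [i vi0].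
exists (fun i => v 0 (enum_rank i)); split.
  by exists (enum_val i); rewrite enum_valK.
under eq_bigr do rewrite (mpolywE (eb _)) scaler_sumr.
rewrite exchange_big big1 //= => m _.
under eq_bigr do rewrite scalerA.
rewrite -scaler_suml (_ : \sum_i _ = (v *m A) 0 (enum_rank m)).
  by rewrite vA mxE scale0r.
rewrite mxE (reindex enum_rank) /=; last first.
  by exists enum_val => x _; [apply: enum_rankK|apply: enum_valK].
by apply: eq_bigr => i' _; rewrite mxE !enum_rankK.
Qed.

End DegreeBounds.

Section Dimension.
Variables (F : fieldType) (m n : nat).
Implicit Types X Y Z : set 'M[F]_(m, n).
Local Notation M := 'M[F]_(m, n).
Local Notation ev p a := p.@[fun k => mxvec a 0 k].

Definition independent_on Z (I : finType) (e : I -> {mpoly F[m * n]}) :=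
  forall c : I -> F, (forall z, Z z -> \sum_i c i * ev (e i) z = 0) ->
  forall i, c i = 0.

(** The coordinate ring of an irreducible set is a domain. *)
Lemma irreducible_mul_eq0 Z (f g : M -> F) :
  irreducible Z -> regular (@mx_coords F m n) f -> regular (@mx_coords F m n)
    g ->
  (forall z, Z z -> f z * g z = 0) -> ~ (forall z, Z z -> f z = 0) ->
  forall z, Z z -> g z = 0.
Proof.
move=> [_ irrZ] rf rg fg nf.
case: (irrZ _ _ (closed_hypersurface rf) (closed_hypersurface rg)) => //.
by move=> z /fg /eqP; rewrite mulf_eq0 => /orP[/eqP|/eqP]; [left|right].
Qed.

Lemma regular_ev p : regular (@mx_coords F m n) (fun a => ev p a).
Proof. by apply: regular_meval => k; apply: (regular_mxvec (@regular_id_mx F m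
  n)). Qed.

(** Read a relation on [Z] as a polynomial in [p] with coefficients in the span of [e]. On [Z'] only
    its constant term survives, and it vanishes by independence there; then one factor [p] cancels
    on the irreducible [Z] and the argument repeats. *)
Lemma independent_step Z' Z (p : {mpoly F[m * n]}) (I : finType) e N :
  irreducible Z -> Z' `<=` Z -> (forall z, Z' z -> ev p z = 0) ->
  ~ (forall z, Z z -> ev p z = 0) -> @independent_on Z' I e ->
  independent_on Z (fun ij : I * 'I_N => e ij.1 * p ^+ ij.2).
Proof.
move=> irrZ Z'Z pZ' pZ inde c cZ.
suff indep k (b : nat -> I -> F) :
    (forall z, Z z -> \sum_(j < k) ev p z ^+ j * \sum_i b j i * ev (e i) z =
      0) ->
    forall j i, (j < k)%N -> b j i = 0.
  (* Coefficients regrouped by the power of [p]; the default 0 only concerns [j] at least [N]. *)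
  pose b j i := if insub j is Some j' then c (i, j') else 0.
  have bE (j : 'I_N) i : b j i = c (i, j) by rewrite /b valK.
  move=> [i j]; rewrite -bE; apply: (indep N) => // z /cZ cz.
  rewrite -[RHS]cz [RHS](eq_bigr (fun ij => c (ij.1, ij.2) *
      (ev (e ij.1) z * ev p z ^+ ij.2))); last first.
    by move=> [i' j'] _ /=; rewrite mevalM rmorphXn.
  rewrite -(pair_bigA _ (fun i j => c (i, j) * (ev (e i) z * ev p z ^+ j))).
  rewrite [RHS]exchange_big /=; apply: eq_bigr => j' _; rewrite mulr_sumr.
  by apply: eq_bigr => i' _; rewrite bE; ring.
elim: k b => // k IHk b bZ.
have b0 : forall i, b 0%N i = 0.
  apply: inde => z Z'z; have := bZ z (Z'Z z Z'z).
  rewrite big_ord_recl expr0 mul1r [X in _ + X]big1 ?addr0 // => j _.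
  by rewrite (pZ' z Z'z) expr0n mul0r.
have bS : forall z, Z z ->
    \sum_(j < k) ev p z ^+ j * \sum_i b j.+1 i * ev (e i) z = 0.
  apply: (irreducible_mul_eq0 irrZ (regular_ev p)) pZ => [|z Zz].
    apply: regular_sum => j; apply: regularM; first exact: regularX
      (regular_ev p).
    by apply: regular_sum => i; apply: regularZ; apply: regular_ev.
  have := bZ z Zz; rewrite big_ord_recl [X in _ * X + _]big1 ?mulr0 ?add0r.
    move=> bz; rewrite -[RHS]bz mulr_sumr.
    by apply: eq_bigr => j _; rewrite exprS mulrA.
  by move=> i _; rewrite b0 mul0r.
by case=> [|j] i ltjk; [apply: b0|apply: (IHk (fun j => b j.+1) bS)].
Qed.

(** Each strict inclusion supplies an equation [p] of the smaller set. Multiplying by its powers up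
    to [N] multiplies the number of independent functions by [N + 1] and adds [O(N)] to the degree,
    with a constant [C] that does not depend on [N]. *)
Lemma chain_independent k (c : nat -> set M) :
  (forall i, (i <= k)%N -> zariski_closed (c i) /\ irreducible (c i)) ->
  (forall i, (i < k)%N -> c i `<` c i.+1) ->
  exists C, forall N, exists (I : finType) (e : I -> {mpoly F[m * n]}),
    [/\ #|I| = (N.+1 ^ k)%N, forall i, (msize (e i) <= (C * N).+1)%N &
        independent_on (c k) e].
Proof.
elim: k => [|k IHk] irrc ltc.
  exists 0%N => N; exists unit, (fun=> 1); split=> [|i|a aZ []].
  - by rewrite card_unit.
  - by rewrite msize1.
  - have [_ [[z Zz] _]] := irrc _ (leqnn 0).
    have := aZ z Zz; rewrite (big_pred1 tt) => [|[] //].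
    by rewrite meval1 mulr1.
have [||C indC] := IHk.
- by move=> i /leqW; apply: irrc.
- by move=> i /leqW; apply: ltc.
have [ck_sub /existsNP [z /not_implyP [ckz nckz]]] := ltc k (leqnn _).
have [[S ckE] _] := irrc k (leqW (leqnn _)).
move: nckz; rewrite {1}ckE => /existsNP [p /not_implyP [Sp pz]].
have [_ irrk] := irrc k.+1 (leqnn _).
exists (C + msize p)%N => N; have [I [e [cardI eC inde]]] := indC N.
exists (I * 'I_N.+1)%type, (fun ij : I * 'I_N.+1 => e ij.1 * p ^+ ij.2); split.
- by rewrite card_prod card_ord cardI expnSr.
- move=> [i j] /=; rewrite mulnDl; apply: msizeM_deg => //.
  apply: leq_trans (msizeX_deg j (leqnSn _)) _.
  by rewrite ltnS leq_mul2l -ltnS ltn_ord orbT.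
- apply: (@independent_step (c k)) => //.
    by move=> y; rewrite ckE => /(_ p Sp).
  by move=> /(_ z ckz) /pz.
Qed.

(** Pulled back along [psi], the independent functions of [chain_independent] become polynomials of
    degree [O(N)] in [D] variables. If [k > D] there are too many of them, and a linear relation
    holds on [X], then on its closure, then on [c k]. *)
Lemma chain_bound D (X : set M) (psi : 'rV[F]_D -> M) k (c : nat -> set M) :
  regular_mx (@mx_coords F 1 D) psi -> X `<=` range psi ->
  (forall i, (i <= k)%N -> zariski_closed (c i) /\ irreducible (c i)) ->
  (forall i, (i < k)%N -> c i `<` c i.+1) ->
  c k `<=` zariski_closure X -> (k <= D)%N.
Proof.
move=> rpsi Xpsi irrc ltc ckX; rewrite leqNgt; apply/negP => ltDk.
have [C indC] := chain_independent irrc ltc.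
have exq (i : 'I_(m * n)) :
    exists q : {mpoly F[D]}, forall v, mxvec (psi v) 0 i = q.@[fun j => v 0 j].
  apply: (@regular_mpoly _ _ (@mx_coords F 1 D) _ (fun (v : 'rV_D) j => v 0 j)).
    by move=> _ [i' [j ->]]; exists j; apply/funext => v; rewrite ord1.
  exact: regular_mxvec rpsi 0 i.
have [q qE] := choice exq.
pose lq := [tuple q i | i < m * n].
pose d := (\max_i msize (q i))%N.
have lqd i : (msize (tnth lq i) <= d.+1)%N.
  by rewrite tnth_mktuple leqW // /d (leq_bigmax i).
pose K := (d * C).+1.
(* With [N = K ^ D] the monomial count satisfies [(K * (N + 1)) ^ D = N * (N + 1) ^ D < (N + 1) ^ (D
   + 1)]. *)
have [I [e [cardI eC inde]]] := indC (K ^ D)%N.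
set N := (K ^ D)%N in cardI eC.
have ltI : ((d * (C * N)).+1 ^ D < #|I|)%N.
  rewrite cardI; apply: (@leq_ltn_trans ((K * N.+1) ^ D)).
    case: (D) => // D'; rewrite leq_exp2r // /K mulSn addSn ltnS mulnA.
    by apply: leq_trans (leq_addl N _); rewrite leq_mul2l leqnSn orbT.
  rewrite expnMn; apply: (@leq_trans (N.+1 ^ D.+1)).
    by rewrite expnS ltn_mul2r expn_gt0 /= ltnS.
  by rewrite leq_pexp2l.
have [a [[i ai0] aE]] := linear_relation (fun i => msize_comp_deg (eC i) lqd)
  ltI.
move: ai0; rewrite (inde a) ?eqxx // => z /ckX.
apply: (@closure_min _ _ _ _ [set z | \sum_i a i * ev (e i) z = 0]).
  apply: closed_hypersurface; apply: regular_sum => j; apply: regularZ.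
  exact: regular_ev.
move=> y /Xpsi [v _ <-] /=.
have /(congr1 (meval (fun j => v 0 j))) := aE; rewrite meval0 raddf_sum /= =>
  a0.
rewrite -[RHS]a0; apply: eq_bigr => j _; rewrite mevalZ comp_mpoly_meval;
  congr (_ * _).
by apply: meval_eq => l; rewrite tnth_mktuple qE.
Qed.

End Dimension.

(** * Explicit sums and determinants in small size *)

Lemma sum3 (V : zmodType) (f : 'I_3 -> V) :
  \sum_i f i = f 0 + f 1 + f ord_max.
Proof.
rewrite !big_ord_recr big_ord0 /= add0r.
by congr (f _ + f _ + f _); apply: val_inj.
Qed.

Lemma ord3P (i : 'I_3) : [\/ i = 0, i = 1 | i = ord_max].
Proof.
case: i => [[|[|[|//]]] lti]; [apply: Or31|apply: Or32|apply: Or33];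
  exact: val_inj.
Qed.

Lemma det_mx22 (R : comRingType) (A : 'M[R]_2) :
  \det A = A 0 0 * A 1 1 - A 0 1 * A 1 0.
Proof.
rewrite (expand_det_row _ 0) big_ord_recl big_ord1 /cofactor !det_mx11 !mxE.
have l00 : lift 0 0 = 1 :> 'I_2 by apply: val_inj.
have l10 : lift 1 0 = 0 :> 'I_2 by apply: val_inj.
by rewrite l00 l10 /= addn0 expr0 expr1 mul1r mulN1r mulrN.
Qed.

Lemma det_mx33 (R : comRingType) (A : 'M[R]_3) :
  \det A = A 0 0 * (A 1 1 * A ord_max ord_max - A 1 ord_max * A ord_max 1)
    - A 0 1 * (A 1 0 * A ord_max ord_max - A 1 ord_max * A ord_max 0)
    + A 0 ord_max * (A 1 0 * A ord_max 1 - A 1 1 * A ord_max 0).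
Proof.
rewrite (expand_det_row _ 0) sum3 /cofactor !det_mx22 !mxE.
have l00 : lift 0 0 = 1 :> 'I_3 by apply: val_inj.
have l01 : lift 0 1 = ord_max :> 'I_3 by apply: val_inj.
have l10 : lift 1 0 = 0 :> 'I_3 by apply: val_inj.
have l11 : lift 1 1 = ord_max :> 'I_3 by apply: val_inj.
have l20 : lift ord_max 0 = 0 :> 'I_3 by apply: val_inj.
have l21 : lift ord_max 1 = 1 :> 'I_3 by apply: val_inj.
rewrite l00 l01 l10 l11 l20 l21 /= !add0n expr0 expr1 sqrrN expr1n.
by rewrite !mul1r mulN1r mulrN.
Qed.

(** * Bases and structures in dimension three *)

Section Bases.
Variable F : fieldType.
Implicit Types x y z u v : 'rV[F]_3.

Definition basis3 x y z := forall a b c, a *: x + b *: y + c *: z = 0 ->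
  [/\ a = 0, b = 0 & c = 0].

Definition indep2 x y := forall a b, a *: x + b *: y = 0 -> a = 0 /\ b = 0.

(** As a linear map on row vectors it sends [e1], [e2], [e3] to [x], [y], [z]. *)
Definition mx3 x y z : 'M[F]_3 := \matrix_i nth 0 [:: x; y; z] i.

Lemma mulmx3 v x y z : v *m mx3 x y z = v 0 0 *: x + v 0 1 *: y + v 0 ord_max
  *: z.
Proof. by rewrite mulmx_sum_row sum3 !rowK. Qed.

Lemma delta3E x y z i : delta_mx 0 i *m mx3 x y z = nth 0 [:: x; y; z] i.
Proof. by rewrite -rowE rowK. Qed.

Lemma e1_mx3 x y z : e1 F *m mx3 x y z = x. Proof. exact: delta3E. Qed.
Lemma e2_mx3 x y z : e2 F *m mx3 x y z = y. Proof. exact: delta3E. Qed.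
Lemma e3_mx3 x y z : e3 F *m mx3 x y z = z. Proof. exact: delta3E. Qed.

Lemma basis3_unit x y z : basis3 x y z <-> mx3 x y z \in unitmx.
Proof.
rewrite -row_free_unit -kermx_eq0; split=> [bas|].
  apply/rowV0P => v /sub_kermxP; rewrite mulmx3 => /bas [v0 v1 v2].
  by apply/rowP => i; rewrite mxE; case: (ord3P i) => ->.
rewrite kermx_eq0 row_free_unit => unitB a b c abc.
pose v := \row_(i < 3) nth 0 [:: a; b; c] i.
have /(congr1 (mulmx^~ (invmx (mx3 x y z)))): v *m mx3 x y z = 0.
  by rewrite mulmx3 !mxE.
rewrite mulmxK // mul0mx => /rowP v0.
by have := v0 0; have := v0 1; have := v0 ord_max; rewrite !mxE.
Qed.

Lemma row3E v : v = v 0 0 *: e1 F + v 0 1 *: e2 F + v 0 ord_max *: e3 F.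
Proof. by rewrite {1}[v]row_sum_delta sum3. Qed.

Lemma basis3_span x y z v : basis3 x y z ->
  exists a b c, v = a *: x + b *: y + c *: z.
Proof.
move=> /basis3_unit unitB; pose w := v *m invmx (mx3 x y z).
by exists (w 0 0), (w 0 1), (w 0 ord_max); rewrite -mulmx3 mulmxKV.
Qed.

Lemma basis3_e : basis3 (e1 F) (e2 F) (e3 F).
Proof.
move=> a b c /rowP abc; have := abc 0; have := abc 1; have := abc ord_max.
by rewrite !mxE /= !mulr0 !mulr1 ?addr0 ?add0r.
Qed.

Lemma exists_notin (A : 'M[F]_3) : (\rank A < 3)%N -> exists v, ~~ (v <= A)%MS.
Proof.
move=> rkA; have : ~~ (1%:M <= A)%MS.
  by apply: contraL rkA => /mxrankS; rewrite mxrank1 -leqNgt.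
by case/row_subPn => i; exists (row i 1%:M).
Qed.

Lemma indep2_complete x : x != 0 -> exists y, indep2 x y.
Proof.
move=> x0; have [|y yx] := @exists_notin <<x>>%MS.
  by rewrite mxrank_gen (leq_ltn_trans (rank_leq_row _)).
exists y => a b ab; have b0 : b = 0.
  apply: contraNeq yx => b0; rewrite genmxE.
  have -> : y = (- a / b) *: x.
    apply: (scalerI b0); rewrite scalerA mulrCA divff // mulr1 scaleNr.
    by apply/eqP; rewrite -addr_eq0 addrC ab.
  exact: scalemx_sub.
split=> //; move: ab; rewrite b0 scale0r addr0 => /eqP.
by rewrite scaler_eq0 (negPf x0) orbF => /eqP.
Qed.

Lemma basis3_complete x y : indep2 x y -> exists z, basis3 x y z.
Proof.
move=> ind; have [|z zxy] := @exists_notin (x + y)%MS.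
  apply: leq_ltn_trans (mxrank_adds_leqif x y) _.
  by rewrite ltnS (@leq_add _ _ 1 1) // rank_leq_row.
exists z => a b c abc; have c0 : c = 0.
  apply: contraNeq zxy => c0.
  have -> : z = (- a / c) *: x + (- b / c) *: y.
    apply: (scalerI c0); rewrite scalerDr !scalerA ![c * _]mulrCA divff //.
    rewrite !mulr1 !scaleNr; apply/eqP.
    by rewrite -subr_eq0 opprD !opprK addrC abc.
  rewrite addmx_sub //; apply: scalemx_sub.
    exact: addsmxSl.
  exact: addsmxSr.
by move: abc; rewrite c0 scale0r addr0 => /ind [].
Qed.

Lemma indep2_dependent x y z : indep2 x y -> ~ basis3 x y z ->
  exists a b, z = a *: x + b *: y.
Proof.
move=> ind dep; apply: contrapT => nz; apply: dep => a b c abc.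
have c0 : c = 0.
  apply: contrapT => /eqP c0; apply: nz; exists (- a / c), (- b / c).
  apply: (scalerI c0); rewrite scalerDr !scalerA ![c * _]mulrCA divff //.
  rewrite !mulr1 !scaleNr; apply/eqP.
  by rewrite -subr_eq0 opprD !opprK addrC abc.
by move: abc; rewrite c0 scale0r addr0 => /ind [].
Qed.

Lemma indep1_dependent x y : x != 0 -> ~ indep2 x y -> exists a, y = a *: x.
Proof.
move=> x0 dep; apply: contrapT => ny; apply: dep => a b ab.
have b0 : b = 0.
  apply: contrapT => /eqP b0; apply: ny; exists (- a / b).
  apply: (scalerI b0); rewrite scalerA mulrCA divff // mulr1 scaleNr.
  by apply/eqP; rewrite -addr_eq0 addrC ab.
split=> //; move: ab; rewrite b0 scale0r addr0 => /eqP.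
by rewrite scaler_eq0 (negPf x0) orbF => /eqP.
Qed.

End Bases.

Section Structures.
Variable F : fieldType.
Implicit Types (mu nu : structure F) (x y z u v : 'rV[F]_3) (g h : 'M[F]_3).

Lemma mulDl mu x y z : mul mu (x + y) z = mul mu x z + mul mu y z.
Proof. by rewrite /mul linearD /= mulmxDl linearD /= mulmxDl. Qed.

Lemma mulDr mu x y z : mul mu x (y + z) = mul mu x y + mul mu x z.
Proof. by rewrite /mul mulmxDr linearD /= mulmxDl. Qed.

Lemma mulZl mu a x y : mul mu (a *: x) y = a *: mul mu x y.
Proof. by rewrite /mul linearZ /= -scalemxAl linearZ /= -scalemxAl. Qed.

Lemma mulZr mu a x y : mul mu x (a *: y) = a *: mul mu x y.
Proof. by rewrite /mul -scalemxAr linearZ /= -scalemxAl. Qed.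

Lemma mul_0l mu x : mul mu 0 x = 0.
Proof. by rewrite -(scale0r (0 : 'rV[F]_3)) mulZl !scale0r. Qed.

Lemma mul_0r mu x : mul mu x 0 = 0.
Proof. by rewrite -(scale0r (0 : 'rV[F]_3)) mulZr !scale0r. Qed.

Lemma mulNl mu x y : mul mu (- x) y = - mul mu x y.
Proof. by rewrite -scaleN1r mulZl scaleN1r. Qed.

Lemma mulNr mu x y : mul mu x (- y) = - mul mu x y.
Proof. by rewrite -scaleN1r mulZr scaleN1r. Qed.

Lemma mul_suml mu I (r : seq I) (f : I -> 'rV_3) y :
  mul mu (\sum_(i <- r) f i) y = \sum_(i <- r) mul mu (f i) y.
Proof. by apply: (big_morph (mul mu ^~ y)); [move=> ? ?; apply: mulDl|apply:
  mul_0l]. Qed.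

Lemma mul_sumr mu I (r : seq I) (f : I -> 'rV_3) x :
  mul mu x (\sum_(i <- r) f i) = \sum_(i <- r) mul mu x (f i).
Proof. by apply: (big_morph (mul mu x)); [move=> ? ?; apply: mulDr|apply:
  mul_0r]. Qed.

Definition mulE := (mulDl, mulDr, mulZl, mulZr, mulNl, mulNr).

Lemma mul_delta mu i j k :
  mul mu (delta_mx 0 i) (delta_mx 0 j) 0 k = mu (mxvec_index i j) k.
Proof. by rewrite /mul trmx_delta mul_delta_mx mxvec_delta -rowE mxE. Qed.

Lemma mulP mu nu : (forall x y, mul mu x y = mul nu x y) -> mu = nu.
Proof.
move=> eqm; apply/matrixP => i k; case/mxvec_indexP: i => i j.
by rewrite -!mul_delta eqm.
Qed.

Lemma mul_of_tableE (t : nat -> nat -> 'rV[F]_3) x y : mul (of_table t) x y =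
  \sum_i \sum_j (x 0 i * y 0 j) *: t i.+1 j.+1.
Proof.
rewrite {1}[x]row_sum_delta {1}[y]row_sum_delta mul_suml.
apply: eq_bigr => i _; rewrite mulZl mul_sumr scaler_sumr.
by apply: eq_bigr => j _; rewrite mulZr mul_of_table scalerA.
Qed.

Lemma act1 mu : act 1%:M mu = mu.
Proof. by apply: mulP => x y; rewrite mul_act invmx1 !mulmx1. Qed.

Lemma actM g h mu : g \in unitmx -> h \in unitmx ->
  act h (act g mu) = act (g *m h) mu.
Proof.
move=> ug uh; apply: mulP => x y; rewrite !mul_act.
by rewrite (invrM ug uh : invmx (g *m h) = _) !mulmxA.
Qed.

Lemma actK g mu : g \in unitmx -> act (invmx g) (act g mu) = mu.
Proof. by move=> ug; rewrite actM ?unitmx_inv // mulmxV // act1. Qed.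

(** Two factors [a^-1] come from the arguments and one factor [a] from the value. *)
Lemma actZ a g mu : a != 0 -> g \in unitmx -> act (a *: g) mu = a^-1 *: act g
  mu.
Proof.
move=> a0 ug; apply: mulP => x y.
have -> : mul (a^-1 *: act g mu) x y = a^-1 *: mul (act g mu) x y.
  by rewrite /mul -scalemxAr.
rewrite !mul_act invmxZ ?unitmxZ ?unitfE // -!scalemxAr mulZl mulZr.
by rewrite -!scalemxAl !scalerA divff // mul1r.
Qed.

Lemma orbit_refl mu : orbit mu mu.
Proof. by exists 1%:M; rewrite /= ?unitmx1 ?act1. Qed.

Lemma orbit_act g mu nu : g \in unitmx -> orbit mu nu -> orbit mu (act g nu).
Proof.
by move=> ug [h /= uh <-]; exists (h *m g); rewrite /= ?unitmx_mul ?uh ?actM.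
Qed.

Lemma orbit_sym mu nu : orbit mu nu -> orbit nu mu.
Proof. by move=> [g /= ug <-]; exists (invmx g); rewrite /= ?unitmx_inv ?actK.
  Qed.

Lemma orbit_trans mu nu rho : orbit mu nu -> orbit nu rho -> orbit mu rho.
Proof. by move=> munu [g /= ug <-]; apply: orbit_act. Qed.

Lemma orbit_isomorphic mu nu : orbit mu nu -> isomorphic mu nu.
Proof.
move=> [g /= ug <-]; exists g; split=> // x y.
by rewrite mul_act !mulmxK.
Qed.

Section RegularStructures.
Variables (T : Type) (X : set (T -> F)).

Lemma regular_mul (mu : T -> structure F) (x y : T -> 'rV[F]_3) :
  regular_mx X mu -> regular_mx X x -> regular_mx X y ->
  regular_mx X (fun t => mul (mu t) (x t) (y t)).
Proof.
move=> rmu rx ry; apply: regular_mulmx => //; apply: regular_mxvec.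
by apply: regular_mulmx => //; apply: regular_trmx.
Qed.

Lemma regular_of_table (f : T -> nat -> nat -> 'rV[F]_3) :
  (forall i j, regular_mx X (fun t => f t i j)) ->
  regular_mx X (fun t => of_table (f t)).
Proof.
move=> rf; apply: regular_summx => i; apply: regular_summx => j.
by apply: regular_mulmx => //; apply: regular_mx_const.
Qed.

Lemma regular_act g (mu : T -> structure F) :
  regular_mx X mu -> regular_mx X (fun t => act g (mu t)).
Proof.
move=> rmu; apply: regular_mulmx; last exact: regular_mx_const.
by apply: regular_mulmx => //; apply: regular_mx_const.
Qed.

End RegularStructures.

Lemma closure_act (X : set (structure F)) g mu : g \in unitmx ->
  (forall nu, X nu -> X (act g nu)) ->
  zariski_closure X mu -> zariski_closure X (act g mu).
Proof.
move=> ug Xg; apply: (@closure_min _ _ _ _ (act g @^-1` zariski_closure X)).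
  apply: closed_preimage; last exact: closure_closed.
  by apply: regular_act; apply: regular_id_mx.
by move=> nu /Xg; apply: sub_closure.
Qed.

Definition mul_comm mu := forall x y, mul mu x y = mul mu y x.

Definition mul_assoc mu :=
  forall x y z, mul mu (mul mu x y) z = mul mu x (mul mu y z).

Lemma in_square_ind mu (P : 'rV[F]_3 -> Prop) : P 0 ->
  (forall a u v, P u -> P v -> P (a *: u + v)) -> (forall x y, P (mul mu x y))
    ->
  forall u, in_square mu u -> P u.
Proof.
move=> P0 PD Pm u [k [c [x [y ->]]]].
by elim/big_rec: _ => // i v _ Pv; apply: PD.
Qed.

End Structures.

(** * The variety as a closed invariant set, and the algebras of the theorem *)

Section DerivedCommAssoc.
Variable F : fieldType.
Implicit Types (mu nu : structure F) (x y z u v : 'rV[F]_3) (g h : 'M[F]_3).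
Local Notation L := (@derived_comm_assoc F).

(** The tool for recognizing normal forms: commutativity reduces the comparison in the basis [x],
    [y], [z] to six products. *)
Lemma act_of_table mu (t : nat -> nat -> 'rV[F]_3) x y z :
  let B := mx3 x y z in
  basis3 x y z -> mul_comm mu -> (forall i j, t i j = t j i) ->
  mul mu x x = t 1 1 *m B -> mul mu x y = t 1 2 *m B ->
  mul mu x z = t 1 3 *m B -> mul mu y y = t 2 2 *m B ->
  mul mu y z = t 2 3 *m B -> mul mu z z = t 3 3 *m B ->
  mu = act B (of_table t).
Proof.
move=> B /basis3_unit uB cmu ct xx xy xz yy yz zz; apply: mulP => u v.
rewrite mul_act mul_of_tableE -{1}[u](mulmxKV uB) -{1}[v](mulmxKV uB).
rewrite mulmx_sum_row [X in mul _ _ X]mulmx_sum_row mul_suml mulmx_suml.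
apply: eq_bigr => i _; rewrite mulZl mul_sumr scaler_sumr mulmx_suml.
apply: eq_bigr => j _; rewrite mulZr scalerA -scalemxAl !rowK; congr (_ *: _).
by case: (ord3P i) => ->; case: (ord3P j) => ->; rewrite //= cmu 1?ct.
Qed.

Lemma in_square_mul mu x y : in_square mu (mul mu x y).
Proof.
by exists 1%N, (fun=> 1), (fun=> x), (fun=> y); rewrite big_ord1 scale1r.
Qed.

(** By trilinearity, associativity on [A^2] can be tested on triples of products, which turns it
    into polynomial equations in the structure constants. *)
Lemma derived_comm_assocP mu : L mu <-> mul_comm mu /\
  forall x x' y y' z z',
    mul mu (mul mu (mul mu x x') (mul mu y y')) (mul mu z z') =
    mul mu (mul mu x x') (mul mu (mul mu y y') (mul mu z z')).
Proof.
split=> [[cmu amu]|[cmu amu]]; split=> //.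
  by move=> *; apply: amu; apply: in_square_mul.
move=> x y z Sx Sy Sz; move: z Sz x Sx y Sy.
apply: in_square_ind => [x _ y _|a u v IHu IHv x Sx y Sy|z z'].
- by rewrite !mul_0r.
- by rewrite !mulE IHu // IHv.
apply: in_square_ind => [y _|a u v IHu IHv y Sy|x x'].
- by rewrite !mul_0l.
- by rewrite !mulE IHu // IHv.
apply: in_square_ind => [|a u v IHu IHv|y y']; last exact: amu.
- by rewrite !(mul_0r, mul_0l).
- by rewrite !mulE IHu IHv.
Qed.

Lemma closed_mul_comm : zariski_closed [set mu : structure F | mul_comm mu].
Proof.
rewrite (_ : mkset _ = [set mu | forall xyk : 'rV[F]_3 * 'rV[F]_3 * 'I_3,
  mul mu xyk.1.1 xyk.1.2 0 xyk.2 - mul mu xyk.1.2 xyk.1.1 0 xyk.2 = 0]).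
  apply: closed_family => xyk; apply: regularB;
  by apply: regular_mul; [apply: regular_id_mx|apply: regular_mx_const..].
apply/seteqP; split=> mu /= cmu; first by move=> [[x y] k] /=; rewrite cmu
  subrr.
by move=> x y; apply/rowP => k; apply/eqP; rewrite -subr_eq0 (cmu (x, y, k)).
Qed.

Lemma closed_derived_comm_assoc : zariski_closed L.
Proof.
pose lhs (w : seq 'rV[F]_3) mu := mul mu (mul mu (mul mu w`_0 w`_1)
  (mul mu w`_2 w`_3)) (mul mu w`_4 w`_5).
pose rhs (w : seq 'rV[F]_3) mu := mul mu (mul mu w`_0 w`_1)
  (mul mu (mul mu w`_2 w`_3) (mul mu w`_4 w`_5)).
rewrite (_ : L = [set mu | mul_comm mu] `&`
  [set mu | forall wk : seq 'rV[F]_3 * 'I_3,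
     lhs wk.1 mu 0 wk.2 - rhs wk.1 mu 0 wk.2 = 0]).
  apply: closedI; first exact: closed_mul_comm.
  by apply: closed_family => wk; apply: regularB;
    do !apply: regular_mul; do ?[exact: regular_id_mx|exact: regular_mx_const].
apply/seteqP; split=> mu /=.
  move=> /derived_comm_assocP [cmu amu]; split=> // wk.
  by rewrite /lhs amu subrr.
move=> [cmu amu]; apply/derived_comm_assocP; split=> // x x' y y' z z'.
apply/rowP => k; apply/eqP; rewrite -subr_eq0.
have := amu ([:: x; x'; y; y'; z; z'], k).
by move=> ->.
Qed.

Lemma derived_comm_assoc_act g mu : g \in unitmx -> L mu -> L (act g mu).
Proof.
move=> ug /derived_comm_assocP [cmu amu]; apply/derived_comm_assocP.
split=> [x y|x x' y y' z z']; first by rewrite !mul_act cmu.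
by rewrite !mul_act !mulmxK // amu.
Qed.

(** By trilinearity only triples of generators matter, and commutativity leaves just the two
    hypotheses. The span need not be closed under the product. *)
Lemma mul_assoc_span2 mu x y : mul_comm mu ->
  mul mu (mul mu x x) y = mul mu x (mul mu x y) ->
  mul mu (mul mu y y) x = mul mu y (mul mu y x) ->
  forall a b c d e f,
    let u := a *: x + b *: y in let v := c *: x + d *: y in
    let w := e *: x + f *: y in
    mul mu (mul mu u v) w = mul mu u (mul mu v w).
Proof.
move=> cmu xxy yyx a b c d e f u v w.
have xxx : mul mu (mul mu x x) x = mul mu x (mul mu x x) by rewrite cmu.
have yyy : mul mu (mul mu y y) y = mul mu y (mul mu y y) by rewrite cmu.
have xyx : mul mu (mul mu x y) x = mul mu x (mul mu x y) by rewrite cmu.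
have yxy : mul mu (mul mu x y) y = mul mu x (mul mu y y).
  by rewrite cmu [mul mu x y]cmu -yyx cmu.
have yx : mul mu y x = mul mu x y by rewrite cmu.
have yxx : mul mu y (mul mu x x) = mul mu x (mul mu x y) by rewrite cmu.
have yxy' : mul mu y (mul mu x y) = mul mu x (mul mu y y).
  by rewrite cmu yxy.
rewrite yx in yyx; rewrite /u /v /w; apply/rowP => k.
rewrite !(mulE, yx) !(xxy, yyx, xxx, yyy, xyx, yxy, yxx, yxy') !mxE; ring.
Qed.

Lemma derived_comm_assoc_span2 mu x y : mul_comm mu ->
  (forall u v, exists a b, mul mu u v = a *: x + b *: y) ->
  mul mu (mul mu x x) y = mul mu x (mul mu x y) ->
  mul mu (mul mu y y) x = mul mu y (mul mu y x) -> L mu.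
Proof.
move=> cmu span xxy yyx; apply/derived_comm_assocP; split=> // u u' v v' w w'.
have [a [b ->]] := span u u'; have [c [d ->]] := span v v'.
by have [e [f ->]] := span w w'; apply: mul_assoc_span2.
Qed.

Lemma mul_J07 x y k : mul (J07 F) x y 0 k = x 0 k * y 0 k.
Proof.
rewrite mul_of_tableE !sum3 /= !mxE /= !mulr0 !addr0 !add0r.
by case: (ord3P k) => ->; rewrite ?(eqxx, mulr1, mulr0, addr0, add0r).
Qed.

Lemma J07_comm : mul_comm (J07 F).
Proof. by move=> x y; apply/rowP => k; rewrite !mul_J07 mulrC. Qed.

Lemma J07_assoc : mul_assoc (J07 F).
Proof. by move=> x y z; apply/rowP => k; rewrite !mul_J07 mulrA. Qed.

Lemma J07_derived_comm_assoc : L (J07 F).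
Proof.
by apply/derived_comm_assocP; split=> [|*]; [apply: J07_comm|apply: J07_assoc].
Qed.

Lemma mul_A01 a b c x y : mul (A01 a b c) x y =
  (x 0 0 * y 0 0 + b * (x 0 1 * y 0 ord_max + x 0 ord_max * y 0 1)
    + x 0 ord_max * y 0 ord_max) *: e1 F +
  (x 0 1 * y 0 1 + a * (x 0 0 * y 0 ord_max + x 0 ord_max * y 0 0)
    + c * (x 0 ord_max * y 0 ord_max)) *: e2 F.
Proof.
rewrite mul_of_tableE !sum3 /=; apply/rowP => k; rewrite !mxE; ring.
Qed.

Lemma A01_comm (a b c : F) : mul_comm (A01 a b c).
Proof.
by move=> x y; rewrite !mul_A01; congr (_ *: _ + _ *: _); ring.
Qed.

Lemma A01_derived_comm_assoc (a b c : F) : L (A01 a b c).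
Proof.
apply: (@derived_comm_assoc_span2 _ (e1 F) (e2 F)).
- exact: A01_comm.
- by move=> u v; rewrite mul_A01; do 2!eexists.
- by apply/rowP => k; rewrite !mul_A01 !mxE /=; ring.
- by apply/rowP => k; rewrite !mul_A01 !mxE /=; ring.
Qed.

End DerivedCommAssoc.

(** * Roots of quadratics and cubics *)

Section Roots.
Variable F : closedFieldType.

Lemma nth_root n (a : F) : (0 < n)%N -> exists r, r ^+ n = a.
Proof.
move=> n0; have [r rE] := @solve_monicpoly F n (fun i => if i == 0%N then a
  else 0) n0.
exists r; rewrite rE; case: n n0 {rE} => // n _.
by rewrite big_ord_recl expr0 mulr1 big1 ?addr0 // => i _; rewrite mul0r.
Qed.

(** The signs fit [X^2 = q X + p], the shape in which relations between powers of an element occur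
    below; likewise for [cubic_roots] and [X^3 = a X^2 + b X + c]. *)
Lemma quadratic_roots (p q : F) : exists r s, q = r + s /\ p = - (r * s).
Proof.
have [r rE] := @solve_monicpoly F 2 (fun i => if i == 0%N then p else q) isT.
rewrite big_ord_recl big_ord1 /= expr0 expr1 mulr1 in rE.
exists r, (q - r); split; first by ring.
have -> : p = r ^+ 2 - q * r by rewrite rE; ring.
ring.
Qed.

Lemma cubic_roots (a b c : F) : exists r s t,
  [/\ a = r + s + t, b = - (r * s + r * t + s * t) & c = r * s * t].
Proof.
have [r rE] := @solve_monicpoly F 3 (nth 0 [:: c; b; a]) isT.
rewrite sum3 /= expr0 expr1 mulr1 in rE.
have [s [t [stE pE]]] := quadratic_roots (b + r * a - r ^+ 2) (a - r).
exists r, s, t; split.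
- by rewrite -addrA -stE; ring.
- have -> : r * s + r * t + s * t = r * (s + t) - (- (s * t)) by ring.
  by rewrite -stE -pE; ring.
- have -> : r * s * t = - (r * - (s * t)) by ring.
  rewrite -pE; have -> : c = r ^+ 3 - b * r - a * r ^+ 2 by rewrite rE; ring.
  ring.
Qed.

End Roots.

(** * Symmetric multiplication tables *)

Section SymmetricTables.
Variable F : fieldType.
Implicit Types (mu nu : structure F) (x y z u v : 'rV[F]_3).
Local Notation e1 := (e1 F).
Local Notation e2 := (e2 F).
Local Notation e3 := (e3 F).

Definition tab3 x11 x12 x13 x22 x23 x33 : nat -> nat -> 'rV[F]_3 :=
  fun i j => match i, j with
    | 1%N, 1%N => x11
    | 1%N, 2%N | 2%N, 1%N => x12
    | 1%N, 3%N | 3%N, 1%N => x13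
    | 2%N, 2%N => x22
    | 2%N, 3%N | 3%N, 2%N => x23
    | 3%N, 3%N => x33
    | _, _ => 0
    end.

Lemma tab3C x11 x12 x13 x22 x23 x33 i j :
  tab3 x11 x12 x13 x22 x23 x33 i j = tab3 x11 x12 x13 x22 x23 x33 j i.
Proof. by case: i => [|[|[|[|i]]]]; case: j => [|[|[|[|j]]]]. Qed.

Lemma act_tab3 mu x y z x11 x12 x13 x22 x23 x33 :
  let B := mx3 x y z in
  basis3 x y z -> mul_comm mu ->
  mul mu x x = x11 *m B -> mul mu x y = x12 *m B ->
  mul mu x z = x13 *m B -> mul mu y y = x22 *m B ->
  mul mu y z = x23 *m B -> mul mu z z = x33 *m B ->
  mu = act B (of_table (tab3 x11 x12 x13 x22 x23 x33)).
Proof. by move=> B bas cmu; apply: act_of_table => // i j; apply: tab3C. Qed.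

Lemma eq_of_table (t t' : nat -> nat -> 'rV[F]_3) : t =2 t' -> of_table t =
  of_table t'.
Proof. by move=> tt'; do 2!apply: eq_bigr => ? _; rewrite tt'. Qed.

Lemma A01_tab3 a b c :
  A01 a b c = of_table (tab3 e1 0 (a *: e2) e2 (b *: e1) (e1 + c *: e2)).
Proof.
apply: eq_of_table => i j.
by case: i => [|[|[|[|i]]]]; case: j => [|[|[|[|j]]]].
Qed.

Section Products.
Variables x11 x12 x13 x22 x23 x33 : 'rV[F]_3.
Local Notation T := (of_table (tab3 x11 x12 x13 x22 x23 x33)).

Lemma mul_tab3E u v : mul T u v = (u 0 0 * v 0 0) *: x11 +
  (u 0 0 * v 0 1 + u 0 1 * v 0 0) *: x12 +
  (u 0 0 * v 0 ord_max + u 0 ord_max * v 0 0) *: x13 + (u 0 1 * v 0 1) *: x22 +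
  (u 0 1 * v 0 ord_max + u 0 ord_max * v 0 1) *: x23 +
  (u 0 ord_max * v 0 ord_max) *: x33.
Proof. by rewrite mul_of_tableE !sum3 /=; apply/rowP => k; rewrite !mxE; ring.
  Qed.

Lemma tab3_comm : mul_comm T.
Proof. by move=> u v; rewrite !mul_tab3E; do ![congr (_ + _)]; congr (_ *: _);
  ring. Qed.

Lemma mul_tab3 : ((mul T e1 e1 = x11) * (mul T e1 e2 = x12) *
  (mul T e1 e3 = x13) * (mul T e2 e1 = x12) * (mul T e2 e2 = x22) *
  (mul T e2 e3 = x23) * (mul T e3 e1 = x13) * (mul T e3 e2 = x23) *
  (mul T e3 e3 = x33))%type.
Proof. by do !split; apply: mul_of_table. Qed.

End Products.

Lemma regular_tab3 T (X : set (T -> F)) (x11 x12 x13 x22 x23 x33 : T ->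
  'rV[F]_3) :
  regular_mx X x11 -> regular_mx X x12 -> regular_mx X x13 ->
  regular_mx X x22 -> regular_mx X x23 -> regular_mx X x33 ->
  regular_mx X (fun t => of_table
    (tab3 (x11 t) (x12 t) (x13 t) (x22 t) (x23 t) (x33 t))).
Proof.
move=> *; apply: regular_of_table => i j.
by case: i => [|[|[|[|i]]]]; case: j => [|[|[|[|j]]]] //=;
  apply: regular_mx_const.
Qed.

Lemma scalemxAl_sym n (a : F) (v : 'rV[F]_n) (B : 'M[F]_n) :
  (a *: v) *m B = a *: (v *m B).
Proof. by rewrite scalemxAl. Qed.

Definition mx3E := (mulmxDl, mulNmx, scalemxAl_sym, mul0mx, e1_mx3, e2_mx3,
  e3_mx3).

End SymmetricTables.

(** * Algebras whose square lies in a plane *)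

Section PlaneAlgebras.
Variable F : numClosedFieldType.
Implicit Types (mu nu : structure F) (x y z u v w : 'rV[F]_3).
Local Notation e1 := (e1 F).
Local Notation e2 := (e2 F).
Local Notation e3 := (e3 F).

Lemma C2_act g mu : g \in unitmx -> C2 mu -> C2 (act g mu).
Proof.
move=> ug; apply: closure_act => // nu [a [b [c abc]]]; exists a, b, c.
exact: orbit_act.
Qed.

Lemma curve_generic (Y : set (structure F)) (gamma : F -> structure F)
    (s : seq F) t : zariski_closed Y -> regular_mx (@line_coord F) gamma ->
  (forall t, t \notin s -> Y (gamma t)) -> Y (gamma t).
Proof.
move=> cY rg sY.
apply: (@curve_closed _ _ _ Y gamma (\prod_(a <- s) ('X - a%:P))) => // [|t'
  t0].
  by rewrite monic_neq0 // monic_prod_XsubC.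
by apply: sY; rewrite -root_prod_XsubC.
Qed.

Lemma C2_curve (gamma : F -> structure F) (s : seq F) t :
  regular_mx (@line_coord F) gamma ->
  (forall t, t \notin s -> C2 (gamma t)) -> C2 (gamma t).
Proof. by apply: curve_generic; apply: closure_closed. Qed.

(** The plane is C^2 with idempotents [x], [y]. Subtracting [a x + d y] from [z] leaves [x z] along
    [y] and [y z] along [x], and the coefficient of [x] in [z z] becomes [e - a^2 - 2 c d]. If this
    is nonzero, dividing by its square root gives a member of [A01]; the exceptional value is
    reached by varying [e]. *)
Lemma C2_idempotents mu x y z a b c d e f : mul_comm mu -> basis3 x y z ->
  mul mu x x = x -> mul mu y y = y -> mul mu x y = 0 ->
  mul mu x z = a *: x + b *: y -> mul mu y z = c *: x + d *: y ->
  mul mu z z = e *: x + f *: y -> C2 mu.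
Proof.
move=> cmu bas xx yy xy xz yz zz.
pose T t := of_table (tab3 e1 0 (a *: e1 + b *: e2) e2 (c *: e1 + d *: e2)
  (t *: e1 + f *: e2)).
have -> : mu = act (mx3 x y z) (T e).
  by apply: act_tab3 => //; rewrite !mx3E.
apply: C2_act; first exact/basis3_unit.
have T_C2 t : t - a ^+ 2 - 2 * c * d != 0 -> C2 (T t).
  move=> t0; have [r rE] := @nth_root F 2 (t - a ^+ 2 - 2 * c * d) isT.
  have r0 : r != 0 by apply: contraNneq t0 => r0; rewrite -rE r0 expr0n.
  have {rE}tE : t = r ^+ 2 + a ^+ 2 + 2 * c * d by rewrite rE; ring.
  pose q := f - 2 * a * b - d ^+ 2.
  pose w := r^-1 *: (e3 - a *: e1 - d *: e2).
  have bas' : basis3 e1 e2 w.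
    move=> i j k; rewrite (_ : i *: e1 + _ + _ =
      (i - k / r * a) *: e1 + (j - k / r * d) *: e2 + (k / r) *: e3); last
        first.
      by apply/rowP => l; rewrite !mxE; ring.
    move=> /basis3_e [i0 j0 k0]; have {}k0 : k = 0.
      by apply: (mulIf (invr_neq0 r0)); rewrite k0 mul0r.
    by move: i0 j0; rewrite k0 !mul0r !subr0.
  apply: sub_closure; exists (b / r), (c / r), (q / r ^+ 2), (mx3 e1 e2 w).
    exact/basis3_unit.
  have cT : mul_comm (T t) by exact: tab3_comm.
  rewrite A01_tab3; symmetry; apply: act_tab3 => //;
    rewrite !mx3E ?/w ?mulE !mul_tab3 ?tE ?/q //;
    by apply/rowP => k; rewrite !mxE; field.
apply: (@C2_curve _ [:: a ^+ 2 + 2 * c * d]).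
- apply: regular_tab3; try exact: regular_mx_const.
  apply: regular_addmx; last exact: regular_mx_const.
  by apply: regular_scalemx; [apply: regular_gen|apply: regular_mx_const].
- by move=> t; rewrite inE -subr_eq0 opprD addrA => /T_C2.
Qed.

(** The plane is generated by [x] with [x^3 = p x + q x^2], that is, it is the ideal of [X] in
    C[X]/(X (X - r) (X - s)). For [r], [s] distinct and nonzero it is C^2, and [C2_idempotents]
    applies; the other cases are limits. *)
Lemma C2_cyclic mu x y z p q a b c d e f : mul_comm mu -> basis3 x y z ->
  mul mu x x = y -> mul mu x y = p *: x + q *: y ->
  mul mu y y = (q * p) *: x + (q ^+ 2 + p) *: y ->
  mul mu x z = a *: x + b *: y -> mul mu y z = c *: x + d *: y ->
  mul mu z z = e *: x + f *: y -> C2 mu.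
Proof.
move=> cmu bas xx xy yy xz yz zz.
have [r [s [qE pE]]] := quadratic_roots p q; subst p q.
pose T r s := of_table (tab3 e2 (- (r * s) *: e1 + (r + s) *: e2)
  (a *: e1 + b *: e2)
  (((r + s) * - (r * s)) *: e1 + ((r + s) ^+ 2 + - (r * s)) *: e2)
  (c *: e1 + d *: e2) (e *: e1 + f *: e2)).
have -> : mu = act (mx3 x y z) (T r s).
  by apply: act_tab3 => //; rewrite !mx3E.
apply: C2_act; first exact/basis3_unit.
have {xx xy yy xz yz zz bas cmu} T_C2 r' s' :
    (r' - s') * r' * s' != 0 -> C2 (T r' s').
  rewrite !mulf_eq0 !negb_or => /andP[/andP[rs0 r0] s0].
  (* Lagrange interpolation, with [e1] as [X] and [e2] as [X^2]: [v] is 1 at [r'] and 0 at [s'], and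
     [w] the reverse; both vanish at 0. They are the orthogonal idempotents. *)
  pose v := (r' * (r' - s'))^-1 *: (e2 - s' *: e1).
  pose w := (s' * (s' - r'))^-1 *: (e2 - r' *: e1).
  have sr0 : s' - r' != 0 by rewrite -opprB oppr_eq0.
  have span al be : al *: e1 + be *: e2 =
      (al * r' + be * r' ^+ 2) *: v + (al * s' + be * s' ^+ 2) *: w.
    by rewrite /v /w; apply/rowP => k; rewrite !mxE; field; rewrite r0 s0 rs0
      sr0.
  apply: (@C2_idempotents _ v w e3).
  - exact: tab3_comm.
  - move=> i j k; rewrite /v /w.
    rewrite (_ : _ + _ + _ = (- (i / r' * s' - j / s' * r') / (r' - s')) *: e1 +
      ((i / r' - j / s') / (r' - s')) *: e2 + k *: e3); last first.
      by apply/rowP => l; rewrite !mxE; field; rewrite r0 s0 rs0 sr0.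
    have irs0 := invr_neq0 rs0.
    move=> /basis3_e [] /eqP; rewrite mulf_eq0 (negPf irs0) orbF oppr_eq0
      subr_eq0.
    move=> /eqP i0 /eqP; rewrite mulf_eq0 (negPf irs0) orbF subr_eq0.
    move=> /eqP j0 k0.
    have jE : j * (r' - s') = 0.
      have -> : j * (r' - s') = s' * (j / s' * r' - j / s' * s') by field.
      by rewrite -i0 -j0 subrr mulr0.
    have {}jE : j = 0 by move/eqP: jE; rewrite mulf_eq0 (negPf rs0) orbF =>
      /eqP.
    move: j0; rewrite jE mul0r => /eqP.
    by rewrite mulf_eq0 (negPf (invr_neq0 r0)) orbF => /eqP.
  - by rewrite /v !mulE !mul_tab3; apply/rowP => k; rewrite !mxE; field;
    rewrite r0 rs0.
  - by rewrite /w !mulE !mul_tab3; apply/rowP => k; rewrite !mxE; field;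
    rewrite s0 sr0.
  - by rewrite /v /w !mulE !mul_tab3; apply/rowP => k; rewrite !mxE; field;
    rewrite r0 s0 rs0 sr0.
  - rewrite {1}/v !mulE !mul_tab3.
    transitivity (((c - s' * a) / (r' * (r' - s'))) *: e1 + ((d - s' * b) /
      (r' * (r' - s'))) *: e2);
      last exact: span.
    by apply/rowP => k; rewrite !mxE; ring.
  - rewrite {1}/w !mulE !mul_tab3.
    transitivity (((c - r' * a) / (s' * (s' - r'))) *: e1 + ((d - r' * b) /
      (s' * (s' - r'))) *: e2);
      last exact: span.
    by apply/rowP => k; rewrite !mxE; ring.
  - by rewrite !mul_tab3; apply: span.
have -> : T r s = T (r + 0) (s + 2 * 0) by rewrite mulr0 !addr0.
(* The roots move at different speeds; the excluded parameters are those where they meet or one of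
   them is zero. *)
apply: (@C2_curve (fun t => T (r + t) (s + 2 * t)) [:: r - s; - r; - s / 2]).
- have rt : regular (@line_coord F) (fun t => r + t).
    by apply: regularD; [apply: regular_const|apply: regular_gen].
  have st : regular (@line_coord F) (fun t => s + 2 * t).
    by apply: regularD; [apply: regular_const|apply: regularZ; apply:
      regular_gen].
  have rc i v : regular (@line_coord F) i -> regular_mx (@line_coord F) (fun t
    => i t *: v).
    by move=> ri; apply: regular_scalemx => //; apply: regular_mx_const.
  apply: regular_tab3; try exact: regular_mx_const.
    apply: regular_addmx; apply: rc; last exact: regularD.
    by apply: regularN; apply: regularM.
  apply: regular_addmx; apply: rc.
    by apply: regularM; [apply: regularD|apply: regularN; apply: regularM].
  by apply: regularD; [apply: regularX; apply: regularD|apply: regularN;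
    apply: regularM].
- move=> t; rewrite !inE !negb_or -!(subr_eq0 t) => /and3P[t1 t2 t3]; apply:
  T_C2.
  have -> : (r + t - (s + 2 * t)) * (r + t) * (s + 2 * t) =
    - 2 * ((t - (r - s)) * (t - - r) * (t - - s / 2)) by field.
  by rewrite !mulf_neq0 // oppr_eq0 pnatr_eq0.
Qed.

(** Deform [x x = 0] to [x x = t y]: for nonzero [t] the plane is cyclic with [p = q = 0]. *)
Lemma C2_null_plane mu x y z a b c d e f : mul_comm mu -> basis3 x y z ->
  mul mu x x = 0 -> mul mu x y = 0 -> mul mu y y = 0 ->
  mul mu x z = a *: x + b *: y -> mul mu y z = c *: x + d *: y ->
  mul mu z z = e *: x + f *: y -> C2 mu.
Proof.
move=> cmu bas xx xy yy xz yz zz.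
pose T t := of_table (tab3 (t *: e2) 0
  (a *: e1 + b *: e2) 0 (c *: e1 + d *: e2) (e *: e1 + f *: e2)).
have -> : mu = act (mx3 x y z) (T 0).
  by apply: act_tab3 => //; rewrite ?scale0r !mx3E.
apply: C2_act; first exact/basis3_unit.
apply: (@C2_curve _ [:: 0]) => [|t].
  apply: regular_tab3; try exact: regular_mx_const.
  by apply: regular_scalemx; [apply: regular_gen|apply: regular_mx_const].
rewrite inE => t0.
apply: (@C2_cyclic _ e1 (t *: e2) e3 0 0 a (b / t) (t * c) d e (f / t)).
- exact: tab3_comm.
- move=> i j k; rewrite scalerA => /basis3_e [-> j0 ->]; split=> //.
  by apply: (mulIf t0); rewrite j0 mul0r.
all: rewrite ?mulE ?mul_tab3 //.
all: by apply/rowP => k; rewrite !mxE; field.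
Qed.

(** Either some [u] in the plane is independent of its square, and the plane is cyclic, or every
    element of the plane has a square proportional to itself, and then associativity makes the
    product on the plane zero. *)
Lemma C2_plane mu x y z : mul_comm mu -> basis3 x y z ->
  (forall u v, exists a b, mul mu u v = a *: x + b *: y) ->
  mul mu (mul mu x x) y = mul mu x (mul mu x y) ->
  mul mu (mul mu y y) x = mul mu y (mul mu y x) -> C2 mu.
Proof.
move=> cmu bas span xxy yyx.
have assoc := mul_assoc_span2 cmu xxy yyx.
have [[i [j]]|noncyc] := pselect (exists i j,
    let u := i *: x + j *: y in indep2 u (mul mu u u)).
  set u := i *: x + j *: y => /= ind.
  have [k [l uuE]] := span u u.
  have bas' : basis3 u (mul mu u u) z.
    move=> a b c abc; have c0 : c = 0.
      have [] // := bas (a * i + b * k) (a * j + b * l) c.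
      by rewrite -abc uuE /u; apply/rowP => m; rewrite !mxE; ring.
    by move: abc; rewrite c0 scale0r addr0 => /ind [].
  have span' v w : exists a b, mul mu v w = a *: u + b *: mul mu u u.
    have [a [b [c vwE]]] := basis3_span (mul mu v w) bas'.
    have [d [e vwE']] := span v w.
    exists a, b; rewrite vwE; have -> : c = 0; last by rewrite scale0r addr0.
    have [] // := bas (a * i + b * k - d) (a * j + b * l - e) c.
    transitivity (mul mu v w - mul mu v w); last by rewrite subrr.
    by rewrite {1}vwE vwE' uuE /u; apply/rowP => m; rewrite !mxE; ring.
  have [p [q xyE]] := span' u (mul mu u u).
  have [a [b xzE]] := span' u z; have [c [d yzE]] := span' (mul mu u u) z.
  have [e [f zzE]] := span' z z.
  have uuuu : mul mu (mul mu u u) (mul mu u u) = mul mu u (mul mu u (mul mu u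
    u)).
    by have := assoc i j i j k l; rewrite /= -/u -uuE.
  apply: (@C2_cyclic _ u (mul mu u u) z p q a b c d e f) => //.
  rewrite uuuu; move: xyE; clear; clearbody u => xyE.
  by rewrite xyE !mulE xyE; apply/rowP => m; rewrite !mxE; ring.
have x0 : x != 0.
  by apply/eqP => x0; have [] := bas 1 0 0; rewrite ?x0 ?scale0r ?scaler0
    ?addr0 // => /eqP; rewrite oner_eq0.
have sq i j : exists a, let u := i *: x + j *: y in mul mu u u = a *: u.
  have [u0|u0] := eqVneq (i *: x + j *: y) 0.
    by exists 0; rewrite /= u0 mul_0l scale0r.
  have [|a aE] := @indep1_dependent _ (i *: x + j *: y)
    (mul mu (i *: x + j *: y) (i *: x + j *: y)) u0; last by exists a.
  by move=> ind; apply: noncyc; exists i, j.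
have yx : mul mu y x = mul mu x y by rewrite cmu.
have [a /=] := sq 1 0; rewrite scale1r scale0r addr0 => xx.
have [b /=] := sq 0 1; rewrite scale1r scale0r add0r => yy.
(* Polarization: the squares of [x + y] and [x - y] both determine [x y], and comparing them gives
   [g = a + b]. *)
have [g /=] := sq 1 1; rewrite !scale1r !mulE yx xx yy => sg.
have [d /=] := sq 1 (-1); rewrite scale1r scaleN1r !mulE yx xx yy => sd.
have xyE : mul mu x y = ((g - a) / 2) *: x + ((g - b) / 2) *: y.
  have -> : mul mu x y = 2^-1 *: ((a *: x + mul mu x y + (mul mu x y + b *: y))
    - a *: x - b *: y) by apply/rowP => k; rewrite !mxE; field.
  by rewrite sg; apply/rowP => k; rewrite !mxE; field.
have [da db _] : [/\ 2 * a - g - d = 0, 2 * b - g + d = 0 & 0 = 0 :> F].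
  move/eqP: sd; rewrite -subr_eq0 xyE => /eqP sd.
  apply: bas; rewrite scale0r addr0 -[RHS]sd.
  by apply/rowP => k; rewrite !mxE; field.
have gE : g = a + b.
  have : 2 * (a + b - g) = 0 by rewrite -[RHS]addr0 -{1}da -db; ring.
  by move/eqP; rewrite mulf_eq0 pnatr_eq0 /= subr_eq0 => /eqP.
have {}xyE : mul mu x y = (b / 2) *: x + (a / 2) *: y.
  by rewrite xyE gE; congr (_ *: _ + _ *: _); ring.
have [_ a0 _] : [/\ 0 = 0 :> F, a ^+ 2 / 4 = 0 & 0 = 0 :> F].
  move: xxy; rewrite xx !mulE xyE !mulE xyE xx => /eqP; rewrite -subr_eq0 =>
    /eqP xxy.
  have [] // := bas (- a * b / 4) (a ^+ 2 / 4) 0; rewrite -?xxy.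
  by apply/rowP => k; rewrite !mxE; field.
have [b0 _ _] : [/\ b ^+ 2 / 4 = 0, 0 = 0 :> F & 0 = 0 :> F].
  move: yyx; rewrite yy !mulE yx xyE !mulE yx xyE yy => /eqP; rewrite
    -subr_eq0 => /eqP yyx.
  have [] // := bas (b ^+ 2 / 4) (- a * b / 4) 0; rewrite -?yyx.
  by apply/rowP => k; rewrite !mxE; field.
have sq0 (t : F) : t ^+ 2 / 4 = 0 -> t = 0.
  by move/eqP; rewrite mulf_eq0 invr_eq0 pnatr_eq0 orbF expf_eq0 /= => /eqP.
move: xx xyE yy; rewrite (sq0 _ a0) (sq0 _ b0) mul0r !scale0r addr0 => xx xyE
  yy.
have [i [j xz]] := span x z; have [k [l yz]] := span y z.
have [m [n zz]] := span z z.
exact: (C2_null_plane cmu bas xx xyE yy xz yz zz).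
Qed.

End PlaneAlgebras.

Section ProperSquare.
Variable F : numClosedFieldType.
Implicit Types (mu nu : structure F) (x y z u v w : 'rV[F]_3).
Local Notation e1 := (e1 F).
Local Notation e2 := (e2 F).
Local Notation e3 := (e3 F).

(** This says [A^2 = A], since a spanning family of products contains a basis. *)
Definition square_full mu := exists x x' y y' z z',
  basis3 (mul mu x x') (mul mu y y') (mul mu z z').

Lemma C2_line_plane mu u v w : mul_comm mu -> basis3 u v w ->
  (forall x y, exists a, mul mu x y = a *: u) -> mul mu u v = 0 ->
  mul mu u u = 0 \/ mul mu v v = 0 -> C2 mu.
Proof.
move=> cmu bas span uv uuvv; have vu : mul mu v u = 0 by rewrite cmu.
have [a uu] := span u u; have [b vv] := span v v.
apply: (C2_plane cmu bas) => [x y||].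
- by have [c ->] := span x y; exists c, 0; rewrite scale0r addr0.
- by rewrite uu uv mul_0r mulZl uv scaler0.
rewrite vu mul_0r; case: uuvv => [uu0|->]; last by rewrite mul_0l.
by rewrite vv mulZl uu0 scaler0.
Qed.

(** The product is a symmetric bilinear form times [u]. By [C2_line_plane] it suffices to find [v]
    orthogonal to [u] with [u] or [v] isotropic. If [u] is isotropic, any orthogonal [v] works;
    otherwise the orthogonal plane of [u] contains an isotropic vector. *)
Lemma C2_line mu u : mul_comm mu -> u != 0 ->
  (forall x y, exists a, mul mu x y = a *: u) -> C2 mu.
Proof.
move=> cmu u0 span; have [v indv] := indep2_complete u0.
have [w bas] := basis3_complete indv.
have bas2 a : basis3 u (w - a *: v) v.
  move=> i j k ijk; have [] := bas i (k - j * a) j.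
    by rewrite -[RHS]ijk; apply/rowP => l; rewrite !mxE; ring.
  by move=> -> kj j0; move: kj; rewrite j0 mul0r subr0 => ->.
have [l uu] := span u u; have [a uv] := span u v; have [b uw] := span u w.
have [l0|l0] := eqVneq l 0.
  rewrite l0 scale0r in uu.
  have [a0|a0] := eqVneq a 0.
    apply: (C2_line_plane cmu bas span); last by left.
    by rewrite uv a0 scale0r.
  apply: (C2_line_plane cmu (bas2 (b / a)) span); last by left.
  by rewrite !mulE uw uv; apply/rowP => k; rewrite !mxE; field.
pose v' := v - (a / l) *: u; pose w' := w - (b / l) *: u.
have uv' : mul mu u v' = 0.
  by rewrite /v' !mulE uv uu; apply/rowP => k; rewrite !mxE; field.
have uw' : mul mu u w' = 0.
  by rewrite /w' !mulE uw uu; apply/rowP => k; rewrite !mxE; field.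
have bas' : basis3 u v' w'.
  move=> i j k; rewrite /v' /w' => ijk.
  have [] := bas (i - j * (a / l) - k * (b / l)) j k.
    by rewrite -[RHS]ijk; apply/rowP => m; rewrite !mxE; ring.
  by move=> + j0 k0; rewrite j0 k0 !mul0r !subr0.
clearbody v' w'.
have [c vv] := span v' v'; have [d vw] := span v' w'; have [e ww] := span w' w'.
have [c0|c0] := eqVneq c 0.
  apply: (C2_line_plane cmu bas' span) => //; right.
  by rewrite vv c0 scale0r.
(* [r] is a root of [c X^2 - 2 d X + e], so that [w' - r v'] is isotropic. *)
have [r [s [rs rsE]]] := quadratic_roots (- (e / c)) (2 * d / c).
have rE : e - 2 * r * d + r ^+ 2 * c = 0.
  have -> : d = c * (r + s) / 2 by rewrite -rs; field.
  have -> : e = c * (r * s) by rewrite -[r * s]opprK -rsE; field.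
  by field.
have bas3 : basis3 u (w' - r *: v') v'.
  move=> i j k ijk; have [] := bas' i (k - j * r) j.
    by rewrite -[RHS]ijk; apply/rowP => m; rewrite !mxE; ring.
  by move=> -> kj j0; move: kj; rewrite j0 mul0r subr0 => ->.
apply: (C2_line_plane cmu bas3 span).
  by rewrite !mulE uv' uw'; apply/rowP => k; rewrite !mxE; ring.
right; rewrite !mulE [mul mu w' v']cmu vv vw ww.
transitivity ((e - 2 * r * d + r ^+ 2 * c) *: u); last by rewrite rE scale0r.
by apply/rowP => k; rewrite !mxE; ring.
Qed.

(** The cases are [A^2] of dimension 0, 1 and 2. In the last one the plane is spanned by products,
    so associativity on it is given. *)
Lemma C2_of_square_proper mu :
  derived_comm_assoc mu -> ~ square_full mu -> C2 mu.
Proof.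
move=> [cmu amu] nfull.
have [[x [x' u0]]|null] := pselect (exists x x', mul mu x x' != 0); last first.
  apply: (@C2_line _ e1) => // [|x y].
    by apply/eqP => /rowP /(_ 0); rewrite !mxE /= => /eqP; rewrite oner_eq0.
  exists 0; rewrite scale0r; apply: contrapT => /eqP xy0.
  by apply: null; exists x, y.
have Su := in_square_mul mu x x'; set u := mul mu x x' in u0 Su.
have [[y [y' uv]]|line] := pselect (exists y y', indep2 u (mul mu y y')); last
  first.
  apply: (@C2_line _ u) => // y y'.
  by apply: (indep1_dependent u0) => uv; apply: line; exists y, y'.
have Sv := in_square_mul mu y y'; set v := mul mu y y' in uv Sv.
have [w bas] := basis3_complete uv.
apply: (C2_plane cmu bas) => [z z'||]; try by apply: amu.
apply: (indep2_dependent uv) => uvw; apply: nfull.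
by exists x, x', y, y', z, z'.
Qed.

End ProperSquare.

(** * Algebras equal to their square *)

Section FullSquare.
Variable F : numClosedFieldType.
Implicit Types (mu nu : structure F) (x y z u v w : 'rV[F]_3).
Local Notation e1 := (e1 F).
Local Notation e2 := (e2 F).
Local Notation e3 := (e3 F).

Definition ideal mu (S : set 'rV[F]_3) :=
  (forall c x y, S x -> S y -> S (c *: x + y)) /\
  (forall a x, S x -> S (mul mu a x)).

(* The determinant trick of Nakayama's lemma, one generator at a time.        *)
Lemma drop_generator mu (S : set 'rV[F]_3) y : mul_comm mu -> mul_assoc mu ->
  ideal mu S ->
  (exists u, forall z, exists a s, S s /\ z - mul mu u z = mul mu a y + s) ->
  exists u, forall z, S (z - mul mu u z).
Proof.
move=> cmu amu [SD SM] [u uE]; have [a [s0 [Ss0 yE]]] := uE y.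
(* Modulo [S], [1 - u] sends everything to multiples of [y], and [1 - u - a] kills [y]. The witness
   is [1 - (1 - u - a) (1 - u)] expanded, with a formal 1. *)
exists (u + u + a - mul mu u u - mul mu a u) => z.
have [b [s [Ss zE]]] := uE z.
have -> : z - mul mu (u + u + a - mul mu u u - mul mu a u) z =
    mul mu b s0 + ((-1) *: mul mu u s + ((-1) *: mul mu a s + s)).
  have mulCA c t : mul mu c (mul mu b t) = mul mu b (mul mu c t).
    by rewrite -amu (cmu c) amu.
  rewrite !mulE !amu.
  have -> : s0 = y - mul mu u y - mul mu a y by rewrite yE addrC addKr.
  have -> : s = z - mul mu u z - mul mu b y by rewrite zE addrC addKr.
  by rewrite !mulE !mulCA; apply/rowP => k; rewrite !mxE; ring.
rewrite -[mul mu b s0]scale1r; apply: (SD); first exact: SM.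
by apply: (SD); [apply: SM|apply: (SD); [apply: SM|]].
Qed.

(** Since [A = A y1 + A y2 + A y3], one may start from [u = 0] and remove the three generators in
    turn, until [z - u z] is zero for all [z]. *)
Lemma unit_of_square_full mu : mul_comm mu -> mul_assoc mu -> square_full mu ->
  exists u, forall x, mul mu u x = x.
Proof.
move=> cmu amu [x1 [y1 [x2 [y2 [x3 [y3 bas]]]]]].
have [u uE] : exists u, forall z, [set 0] (z - mul mu u z); last first.
  by exists u => x; apply/eqP; rewrite eq_sym -subr_eq0; apply/eqP; apply: uE.
apply: (@drop_generator _ _ y1) => //.
  by split=> [c x y -> ->|a x ->]; rewrite ?scaler0 ?addr0 ?mul_0r.
have [u uE] : exists u, forall z, [set s | exists a, s = mul mu a y1] (z - mul
  mu u z).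
  apply: (@drop_generator _ _ y2) => //.
    split=> [c _ _ [a ->] [b ->]|a _ [b ->]].
      by exists (c *: a + b); rewrite !mulE.
    by exists (mul mu a b); rewrite amu.
  have [u uE] : exists u, forall z, [set s | exists a b, s = mul mu a y1 + mul
    mu b y2]
      (z - mul mu u z).
    apply: (@drop_generator _ _ y3) => //.
      split=> [c _ _ [a [b ->]] [a' [b' ->]]|a _ [b [b' ->]]].
        exists (c *: a + a'), (c *: b + b'); rewrite !mulE.
        by apply/rowP => k; rewrite !mxE; ring.
      by exists (mul mu a b), (mul mu a b'); rewrite !mulE !amu.
    exists 0 => z; have [a [b [c zE]]] := basis3_span z bas.
    exists (c *: x3), (mul mu (a *: x1) y1 + mul mu (b *: x2) y2); split.
      by exists (a *: x1), (b *: x2).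
    by rewrite mul_0l subr0 {1}zE !mulE addrC.
  exists u => z; have [a [b zE]] := uE z.
  by exists b, (mul mu a y1); split; [exists a|rewrite zE addrC].
exists u => z; have [a zE] := uE z.
by exists a, 0; split; rewrite // zE addr0.
Qed.

(** C[X]/((X - r) (X - s) (X - t)) in the basis 1, X, X^2. *)
Definition cubic_structure (r s t : F) :=
  let p := r + s + t in let q := r * s + r * t + s * t in let m := r * s * t in
  of_table (tab3 e1 e2 e3 e3 (m *: e1 + (- q) *: e2 + p *: e3)
    ((p * m) *: e1 + (m - p * q) *: e2 + (p ^+ 2 - q) *: e3)).

Definition split_structure (s t : F) :=
  of_table (tab3 e1 e2 e3 (s *: e2) 0 (t *: e3)).

(** If 1, [x], [x^2] is a basis for some [x], the cubic relation of [x] decides. Otherwise each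
    element is quadratic over the unit, and two of them, shifted by roots of their quadratics and
    then once more, have product zero. *)
Lemma unital_classification mu : mul_comm mu -> mul_assoc mu ->
  (exists u, forall x, mul mu u x = x) ->
  (exists g r s t, g \in unitmx /\ mu = act g (cubic_structure r s t)) \/
  (exists g s t, g \in unitmx /\ mu = act g (split_structure s t)).
Proof.
move=> cmu amu [u ux]; have xu x : mul mu x u = x by rewrite cmu.
have [[x bas]|noncyc] := pselect (exists x, basis3 u x (mul mu x x)).
  left; have [a [b [c xE]]] := basis3_span (mul mu x (mul mu x x)) bas.
  have [r [s [t [cE bE aE]]]] := cubic_roots c b a.
  exists (mx3 u x (mul mu x x)), r, s, t; split; first exact/basis3_unit.
  apply: act_tab3 => //; rewrite ?mx3E ?ux //.
    by rewrite xE aE bE cE; apply/rowP => k; rewrite !mxE; ring.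
  rewrite amu xE !mulE xu xE aE bE cE; apply/rowP => k; rewrite !mxE; ring.
right; have u0 : u != 0.
  apply/eqP => u0; have := ux e1; rewrite u0 mul_0l => /rowP /(_ 0).
  by rewrite !mxE /= => /eqP; rewrite eq_sym oner_eq0.
have quad x : indep2 u x -> exists c t, mul mu (x - c *: u) (x - c *: u) = t
  *: (x - c *: u).
  move=> ind; have [a [b xx]] : exists a b, mul mu x x = a *: u + b *: x.
    by apply: indep2_dependent => // bas; apply: noncyc; exists x.
  have [r [s [bE aE]]] := quadratic_roots a b.
  exists r, (s - r); rewrite !mulE !xu !ux xx aE bE.
  by apply/rowP => k; rewrite !mxE; ring.
have [x' indx] := indep2_complete u0; have [y' bas'] := basis3_complete indx.
have [c [t]] := quad x' indx; set x := x' - c *: u => xx.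
have indy : indep2 u y'.
  by move=> a b ab; have [|-> _ ->] := bas' a 0 b; rewrite ?scale0r ?addr0.
have [d [t' ]] := quad y' indy; set y := y' - d *: u => yy.
have bas : basis3 u x y.
  move=> i j k; rewrite /x /y => ijk; have [] := bas' (i - j * c - k * d) j k.
    by rewrite -[RHS]ijk; apply/rowP => m; rewrite !mxE; ring.
  by move=> + j0 k0; rewrite j0 k0 !mul0r !subr0.
clearbody x y => {indx indy bas' x' y' noncyc quad}.
have [a [b [e xy]]] := basis3_span (mul mu x y) bas.
have yx : mul mu y x = mul mu x y by rewrite cmu.
(* Coefficients of [(x x) y = x (x y)]. With the symmetric relation they make [x - e] and [y - b]
   annihilate each other and keep their squares proportional to themselves. *)
have [ea aeb ee] : [/\ e * a - t * a = 0, a + e * b = 0 & e * e - t * e = 0].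
  apply: bas; have /eqP := amu x x y; rewrite -subr_eq0 => /eqP x2y.
  rewrite -[LHS]opprK -[RHS]oppr0 -x2y xx xy !mulE xu xx xy.
  by congr (- _); apply/rowP => k; rewrite !mxE; ring.
have bb : b * b - t' * b = 0.
  have [] // := bas (b * a - t' * a) (b * b - t' * b) (a + b * e).
  have /eqP := amu y y x; rewrite -subr_eq0 => /eqP y2x.
  rewrite -[LHS]opprK -[RHS]oppr0 -y2x yx yy xy !mulE xu yx yy xy.
  by congr (- _); apply/rowP => k; rewrite !mxE; ring.
have aE : a = - (e * b) by apply/eqP; rewrite -addr_eq0 aeb.
exists (mx3 u (x - e *: u) (y - b *: u)), (t - 2 * e), (t' - 2 * b); split.
  apply/basis3_unit => i j k ijk.
  have [] := bas (i - j * e - k * b) j k.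
    by rewrite -[RHS]ijk; apply/rowP => m; rewrite !mxE; ring.
  by move=> + j0 k0; rewrite j0 k0 !mul0r !subr0.
have {}bas : basis3 u (x - e *: u) (y - b *: u).
  move=> i j k ijk; have [] := bas (i - j * e - k * b) j k.
    by rewrite -[RHS]ijk; apply/rowP => m; rewrite !mxE; ring.
  by move=> + j0 k0; rewrite j0 k0 !mul0r !subr0.
apply: act_tab3 => //; rewrite ?mx3E ?mulE ?xu ?ux //.
- transitivity ((t - 2 * e) *: (x - e *: u) - (e * e - t * e) *: u).
    by rewrite xx; apply/rowP => k; rewrite !mxE; ring.
  by rewrite ee scale0r subr0.
- by rewrite xy aE; apply/rowP => k; rewrite !mxE; ring.
- transitivity ((t' - 2 * b) *: (y - b *: u) - (b * b - t' * b) *: u).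
    by rewrite yy; apply/rowP => k; rewrite !mxE; ring.
  by rewrite bb scale0r subr0.
Qed.

End FullSquare.

(** * Limits of C^3 and the decomposition of the variety *)

Section C1Membership.
Variable F : numClosedFieldType.
Implicit Types (mu nu : structure F) (x y z u v w : 'rV[F]_3).
Local Notation e1 := (e1 F).
Local Notation e2 := (e2 F).
Local Notation e3 := (e3 F).

Lemma C1_act g mu : g \in unitmx -> C1 mu -> C1 (act g mu).
Proof. by move=> ug; apply: closure_act => // nu; apply: orbit_act. Qed.

Definition row3 (a b c : F) : 'rV[F]_3 := \row_i nth 0 [:: a; b; c] i.

(** Chinese remainders: evaluating 1, X, X^2 at the roots gives the rows of a Vandermonde matrix. *)
Lemma cubic_structure_orbit r s t : r != s -> r != t -> s != t ->
  orbit (J07 F) (cubic_structure r s t).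
Proof.
move=> rs rt st; apply: orbit_sym.
pose B := mx3 (row3 1 1 1) (row3 r s t) (row3 (r ^+ 2) (s ^+ 2) (t ^+ 2)).
have uB : B \in unitmx.
  rewrite unitmxE unitfE det_mx33 !mxE /= ?mxE /=.
  rewrite (_ : _ + _ = (s - r) * (t - r) * (t - s)); last by ring.
  by rewrite !mulf_neq0 // subr_eq0 eq_sym.
exists B => //=; symmetry; apply: act_tab3; first exact/basis3_unit.
  exact: J07_comm.
all: apply/rowP => k; rewrite ?mx3E mul_J07 !mxE.
all: by case: (ord3P k) => -> /=; ring.
Qed.

Lemma split_structure_orbit s t : s != 0 -> t != 0 ->
  orbit (J07 F) (split_structure s t).
Proof.
move=> s0 t0; apply: orbit_sym.
pose B := mx3 (row3 1 1 1) (row3 s 0 0) (row3 0 t 0).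
have uB : B \in unitmx.
  rewrite unitmxE unitfE det_mx33 !mxE /= ?mxE /=.
  by rewrite (_ : _ + _ = s * t) ?mulf_neq0 //; ring.
exists B => //=; symmetry; apply: act_tab3; first exact/basis3_unit.
  exact: J07_comm.
all: apply/rowP => k; rewrite ?mx3E mul_J07 !mxE.
all: by case: (ord3P k) => -> /=; ring.
Qed.

Lemma C1_cubic (r s t : F) : C1 (cubic_structure r s t).
Proof.
pose gamma (i : F) := cubic_structure (r + i) (s + 2 * i) (t + 3 * i).
have -> : cubic_structure r s t = gamma 0 by rewrite /gamma !mulr0 !addr0.
(* The roots move at speeds 1, 2, 3; these are the parameters where two of them collide. *)
apply: (@curve_generic _ _ _ [:: r - s; (r - t) / 2; s - t]).
- exact: closure_closed.
- have rc (a b : F) : regular (@line_coord F) (fun i => a + b * i).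
    by apply: regularD; [apply: regular_const|apply: regularZ; apply:
      regular_gen].
  have r1 : regular (@line_coord F) (fun i => r + i).
    by apply: eq_regular (rc r 1) => i; rewrite mul1r.
  have rz (f : F -> F) v : regular (@line_coord F) f ->
      regular_mx (@line_coord F) (fun i => f i *: v : 'rV[F]_3).
    by move=> rf; apply: regular_scalemx => //; apply: regular_mx_const.
  apply: regular_tab3; try exact: regular_mx_const.
    do 2?apply: regular_addmx; apply: rz;
    by do ?[exact: r1|exact: rc|apply: regularN|apply: regularD|apply:
      regularM].
  do 2?apply: regular_addmx; apply: rz;
  by do ?[exact: r1|exact: rc|apply: regularN|apply: regularX|apply:
    regularD|apply: regularM].
move=> i; rewrite !inE !negb_or => /and3P[i1 i2 i3]; apply: sub_closure.
apply: cubic_structure_orbit; rewrite -subr_eq0.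
- by apply: contraNneq i1 => i1; rewrite -subr_eq0 -oppr_eq0 -i1; apply/eqP;
  ring.
- apply: contraNneq i2 => i2; rewrite -subr_eq0; apply/eqP.
  have -> : i - (r - t) / 2 = - (r + i - (t + 3 * i)) / 2 by field.
  by rewrite i2 oppr0 mul0r.
- by apply: contraNneq i3 => i3; rewrite -subr_eq0 -oppr_eq0 -i3; apply/eqP;
  ring.
Qed.

Lemma C1_split (s t : F) : C1 (split_structure s t).
Proof.
pose gamma (i : F) := split_structure (s + i) (t + i).
have -> : split_structure s t = gamma 0 by rewrite /gamma !addr0.
apply: (@curve_generic _ _ _ [:: - s; - t]).
- exact: closure_closed.
- have rc (a : F) : regular (@line_coord F) (fun i => a + i).
    by apply: regularD; [apply: regular_const|apply: regular_gen].
  by apply: regular_tab3; try exact: regular_mx_const;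
    apply: regular_scalemx (rc _) _; apply: regular_mx_const.
move=> i; rewrite !inE !negb_or -!addr_eq0 ![i + _]addrC => /andP[i1 i2].
by apply: sub_closure; apply: split_structure_orbit.
Qed.

Lemma square_full_assoc mu : derived_comm_assoc mu -> square_full mu ->
  mul_assoc mu.
Proof.
move=> [cmu amu] [x1 [y1 [x2 [y2 [x3 [y3 bas]]]]]].
have sq v : in_square mu v.
  have [a [b [c ->]]] := basis3_span v bas.
  exists 3%N, (fun i : 'I_3 => nth 0 [:: a; b; c] i),
    (fun i : 'I_3 => nth 0 [:: x1; x2; x3] i), (fun i : 'I_3 => nth 0 [:: y1;
      y2; y3] i).
  by rewrite sum3.
by move=> x y z; apply: amu.
Qed.

Lemma C1_of_square_full mu : derived_comm_assoc mu -> square_full mu -> C1 mu.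
Proof.
move=> Lmu full; have [cmu _] := Lmu; have amu := square_full_assoc Lmu full.
case: (unital_classification cmu amu (unit_of_square_full cmu amu full)).
  by move=> [g [r [s [t [ug ->]]]]]; apply: C1_act ug (C1_cubic r s t).
by move=> [g [s [t [ug ->]]]]; apply: C1_act ug (C1_split s t).
Qed.

Lemma C1_sub : @C1 F `<=` @derived_comm_assoc F.
Proof.
apply: closure_min; first exact: closed_derived_comm_assoc.
by move=> _ [g ug <-]; apply: derived_comm_assoc_act (J07_derived_comm_assoc F).
Qed.

Lemma C2_sub : @C2 F `<=` @derived_comm_assoc F.
Proof.
apply: closure_min; first exact: closed_derived_comm_assoc.
move=> _ [a [b [c [g ug <-]]]].
by apply: derived_comm_assoc_act (A01_derived_comm_assoc a b c).
Qed.

Lemma derived_comm_assocU : @derived_comm_assoc F = @C1 F `|` @C2 F.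
Proof.
apply/seteqP; split=> mu; last by case; [apply: C1_sub|apply: C2_sub].
move=> Lmu; have [full|proper] := pselect (square_full mu).
  by left; apply: C1_of_square_full.
by right; apply: C2_of_square_proper.
Qed.

End C1Membership.

(** * Parametrization of the components *)

Section Parametrization.
Variable F : numClosedFieldType.

(** The action with the inverse replaced by an independent matrix [h], hence polynomial in [h] and
    [g]. *)
Definition twist (h g : 'M[F]_3) (mu : structure F) : structure F :=
  lin_mx (mulmx h^T \o mulmxr h) *m mu *m g.

Lemma mul_twist h g mu x y : mul (twist h g mu) x y = mul mu (x *m h) (y *m h)
  *m g.
Proof.
by rewrite /mul /twist -!mulmxA [LHS]mulmxA mul_vec_lin /= trmx_mul !mulmxA.
Qed.

Lemma regular_twist T (X : set (T -> F)) (h g : T -> 'M[F]_3) mu :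
  regular_mx X h -> regular_mx X g -> regular_mx X mu ->
  regular_mx X (fun t => twist (h t) (g t) (mu t)).
Proof.
move=> rh rg rmu i k; case/mxvec_indexP: i => i j.
apply: (@eq_regular _ _ _ (fun t =>
  (mul (mu t) (delta_mx 0 i *m h t) (delta_mx 0 j *m h t) *m g t) 0 k)) => [t|].
  by rewrite -mul_twist mul_delta.
apply: regular_mulmx => //; apply: regular_mul => //;
  by apply: regular_mulmx => //; apply: regular_mx_const.
Qed.

Lemma twist_adj g mu : g \in unitmx -> twist (\adj g) g mu = (\det g) ^+ 2 *:
  act g mu.
Proof.
move=> ug; have d0 : \det g != 0 by rewrite -unitfE -unitmxE.
apply: mulP => x y.
have -> : mul (\det g ^+ 2 *: act g mu) x y = \det g ^+ 2 *: mul (act g mu) x y.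
  by rewrite /mul -scalemxAr.
rewrite mul_twist mul_act /invmx ug -!scalemxAr mulZl mulZr -!scalemxAl
  !scalerA.
by rewrite expr2 mulrACA divff // mul1r scale1r.
Qed.

Variable T : 'rV[F]_3 -> structure F.

(** Nine coordinates hold the matrix and three the parameters of [T]: the 12 of the dimension
    bound. *)
Definition param_mx (v : 'rV[F]_(3 * 3 + 3)) : 'M[F]_3 := vec_mx (lsubmx v).

(* Rescaling by det^2 removes the denominators of the action; over an         *)
(* algebraically closed field it is absorbed by rescaling g.                  *)
Definition param v := twist (\adj (param_mx v)) (param_mx v) (T (rsubmx v)).

Definition family := [set mu | exists p, orbit (T p) mu].

Lemma regular_param_mx : regular_mx (@mx_coords F 1 (3 * 3 + 3)) param_mx.
Proof.
apply: regular_vec_mx => i j.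
by apply: eq_regular (@regular_id_mx F 1 (3 * 3 + 3) i (lshift 3 j)) => v;
  rewrite mxE.
Qed.

Lemma regular_param : regular_mx (@mx_coords F 1 3) T ->
  regular_mx (@mx_coords F 1 (3 * 3 + 3)) param.
Proof.
move=> regT.
apply: regular_twist; [apply: regular_adj|..]; try exact: regular_param_mx.
move=> i j; apply: (@regular_mx_comp _ _ _ _ _ (@rsubmx F 1 (3 * 3) 3)) (regT
  i j).
move=> i' j'.
by apply: eq_regular (@regular_id_mx F 1 (3 * 3 + 3) i' (rshift (3 * 3) j'))
  => v; rewrite mxE.
Qed.

Lemma family_param : family = param @` [set v | \det (param_mx v) != 0].
Proof.
apply/seteqP; split=> mu.
  move=> [p [h /= uh <-]]; have h0 : \det h != 0 by rewrite -unitfE -unitmxE.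
  (* For [g = s h] the factor [\det g ^+ 2] contributes [s^6] and [actZ] contributes [s^-1], so
     [s^5] must cancel [\det h ^+ 2]. *)
  have [s sE] := @nth_root F 5 (\det h ^- 2) isT.
  have s0 : s != 0.
    apply/eqP => s0; move/esym/eqP: sE; rewrite s0 expr0n invr_eq0 expf_eq0 /=.
    by rewrite (negPf h0).
  have gE : param_mx (row_mx (mxvec (s *: h)) p) = s *: h.
    by rewrite /param_mx row_mxKl mxvecK.
  have us : s *: h \in unitmx by rewrite unitmxZ ?unitfE.
  exists (row_mx (mxvec (s *: h)) p) => /=; rewrite /param gE.
    by rewrite -unitfE -unitmxE.
  rewrite row_mxKr twist_adj // detZ actZ // scalerA.
  rewrite (_ : _ / s = 1) ?scale1r //.
  have -> : 1 = s ^+ 5 * \det h ^+ 2 by rewrite sE mulVf // expf_neq0.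
  by field.
move=> [v /= d0 <-]; exists (rsubmx v).
have ug : param_mx v \in unitmx by rewrite unitmxE unitfE.
have a0 : \det (param_mx v) ^- 2 != 0 by rewrite invr_eq0 expf_neq0.
exists (\det (param_mx v) ^- 2 *: param_mx v); rewrite /= ?unitmxZ ?unitfE //.
by rewrite actZ // invrK /param twist_adj.
Qed.

Lemma family_irreducible : regular_mx (@mx_coords F 1 3) T ->
  irreducible (zariski_closure family).
Proof.
move=> regT; rewrite family_param; apply: image_irreducible.
- by apply: regular_det; apply: regular_param_mx.
- exact: regular_param.
exists (row_mx (mxvec 1%:M) 0).
by rewrite /param_mx row_mxKl mxvecK det1 oner_eq0.
Qed.

Lemma family_range : family `<=` range param.
Proof. by rewrite family_param => _ [v _ <-]; exists v. Qed.

End Parametrization.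

Section Components.
Variable F : numClosedFieldType.

Lemma C1_family : @C1 F = zariski_closure (family (fun=> J07 F)).
Proof.
congr zariski_closure; apply/seteqP; split=> mu; first by exists 0.
by case.
Qed.

Definition A01_row (p : 'rV[F]_3) : structure F := A01 (p 0 0) (p 0 1) (p 0
  ord_max).

Lemma C2_family : @C2 F = zariski_closure (family A01_row).
Proof.
congr zariski_closure; apply/seteqP; split=> mu; last first.
  by move=> [p]; exists (p 0 0), (p 0 1), (p 0 ord_max).
by move=> [a [b [c abc]]]; exists (row3 a b c); rewrite /A01_row !mxE.
Qed.

Lemma regular_J07 : regular_mx (@mx_coords F 1 3) (fun=> J07 F).
Proof. exact: regular_mx_const. Qed.

Lemma regular_A01_row : regular_mx (@mx_coords F 1 3) A01_row.
Proof.
have -> : A01_row = fun p => of_table (tab3 (e1 F) 0 (p 0 0 *: e2 F) (e2 F)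
    (p 0 1 *: e1 F) (e1 F + p 0 ord_max *: e2 F)).
  by apply/funext => p; rewrite /A01_row A01_tab3.
have rc i v : regular_mx (@mx_coords F 1 3) (fun p => p 0 i *: v : 'rV[F]_3).
  by apply: regular_scalemx; [apply: regular_id_mx|apply: regular_mx_const].
apply: regular_tab3; try exact: regular_mx_const; try exact: rc.
by apply: regular_addmx (rc _ _); apply: regular_mx_const.
Qed.

Lemma C1_irreducible : irreducible (@C1 F).
Proof. by rewrite C1_family; apply: family_irreducible regular_J07. Qed.

Lemma C2_irreducible : irreducible (@C2 F).
Proof. by rewrite C2_family; apply: family_irreducible regular_A01_row. Qed.

(** The top of the chain is irreducible, so it lies in [C1] or in [C2], and [chain_bound] applies to
    the parametrization of that component. *)
Lemma dimension_le12 k (c : nat -> set (structure F)) :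
  irreducible_chain (@derived_comm_assoc F) k c -> (k <= 12)%N.
Proof.
move=> [irrc ltc].
have clc i : (i <= k)%N -> zariski_closed (c i) /\ irreducible (c i).
  move=> /irrc [[Y [cY ->]] irr]; split=> //.
  exact: closedI (closed_derived_comm_assoc F) cY.
have [[Y [_ ckE]] [_ irrk]] := irrc k (leqnn k).
have ckU : c k `<=` @C1 F `|` @C2 F.
  by rewrite -derived_comm_assocU ckE => mu [].
have [ckC|ckC] : c k `<=` @C1 F \/ c k `<=` @C2 F.
  exact: irrk (closure_closed _) (closure_closed _) ckU.
  rewrite C1_family in ckC.
  exact: chain_bound (regular_param regular_J07) (@family_range F _) clc ltc
    ckC.
rewrite C2_family in ckC.
exact: chain_bound (regular_param regular_A01_row) (@family_range F _) clc ltc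
  ckC.
Qed.

End Components.

(** * Trace discriminants and rigidity *)

Section Invariants.
Variable F : fieldType.
Implicit Types (mu nu : structure F) (x y z u v w : 'rV[F]_3) (g h : 'M[F]_3).

Definition right_mul_mx mu y : 'M[F]_3 :=
  \matrix_(i, j) mul mu (delta_mx 0 i) y 0 j.

Lemma mul_right_mul_mx mu x y : x *m right_mul_mx mu y = mul mu x y.
Proof.
rewrite {2}[x]row_sum_delta mul_suml mulmx_sum_row; apply: eq_bigr => i _.
by rewrite mulZl; congr (_ *: _); apply/rowP => j; rewrite !mxE.
Qed.

Lemma right_mul_mxD mu y z :
  right_mul_mx mu (y + z) = right_mul_mx mu y + right_mul_mx mu z.
Proof.
apply/row_matrixP => i.
by rewrite !rowE mulmxDr !mul_right_mul_mx mulDr.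
Qed.

Lemma right_mul_mxZ mu a y : right_mul_mx mu (a *: y) = a *: right_mul_mx mu y.
Proof.
apply/row_matrixP => i.
by rewrite !rowE -scalemxAr !mul_right_mul_mx mulZr.
Qed.

Lemma right_mul_mx_act g mu y : g \in unitmx ->
  right_mul_mx (act g mu) y = invmx g *m right_mul_mx mu (y *m invmx g) *m g.
Proof.
move=> ug; apply/row_matrixP => i; rewrite !rowE mul_right_mul_mx mul_act.
by rewrite !mulmxA mul_right_mul_mx.
Qed.

Lemma det_right_mul_mx_act g mu y : g \in unitmx ->
  \det (right_mul_mx (act g mu) y) = \det (right_mul_mx mu (y *m invmx g)).
Proof.
move=> ug; rewrite right_mul_mx_act // !det_mulmx det_inv mulrAC mulVf ?mul1r
  //.
by rewrite -unitfE -unitmxE.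
Qed.

Lemma trace_conj g (A : 'M[F]_3) : g \in unitmx -> \tr (invmx g *m A *m g) =
  \tr A.
Proof. by move=> ug; rewrite mxtrace_mulC mulmxA mulmxV // mul1mx. Qed.

Definition trace_mul mu x y := \tr (right_mul_mx mu (mul mu x y)).

(** It agrees with [trace_mul] on associative algebras, but not on all of [A01]. *)
Definition trace_comp mu x y := \tr (right_mul_mx mu x *m right_mul_mx mu y).

Lemma trace_mul_act g mu x y : g \in unitmx ->
  trace_mul (act g mu) x y = trace_mul mu (x *m invmx g) (y *m invmx g).
Proof.
by move=> ug; rewrite /trace_mul right_mul_mx_act // trace_conj // mul_act
  mulmxK.
Qed.

Lemma trace_comp_act g mu x y : g \in unitmx ->
  trace_comp (act g mu) x y = trace_comp mu (x *m invmx g) (y *m invmx g).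
Proof.
move=> ug; rewrite /trace_comp !right_mul_mx_act // -!mulmxA [g *m (_ *m
  _)]mulmxA.
by rewrite mulmxV // mul1mx !mulmxA -[X in \tr (X *m g)]mulmxA trace_conj.
Qed.

Definition bilinear_form (b : 'rV[F]_3 -> 'rV[F]_3 -> F) :=
  [/\ forall x y z, b (x + y) z = b x z + b y z,
      forall a x z, b (a *: x) z = a * b x z,
      forall x y z, b z (x + y) = b z x + b z y &
      forall a x z, b z (a *: x) = a * b z x].

Definition gram (b : 'rV[F]_3 -> 'rV[F]_3 -> F) : 'M[F]_3 :=
  \matrix_(i, j) b (delta_mx 0 i) (delta_mx 0 j).

Lemma gram_base_change b c h : bilinear_form b ->
  (forall x y, c x y = b (x *m h) (y *m h)) -> gram c = h *m gram b *m h^T.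
Proof.
move=> [bDl bZl bDr bZr] cE; apply/matrixP => i j; rewrite mxE cE -!rowE.
rewrite [row i h]row3E [row j h]row3E !(bDl, bZl, bDr, bZr).
rewrite !mxE sum3 !mxE !sum3 !mxE /e1 /e2 /e3; ring.
Qed.

Lemma trace_mul_bilinear mu : bilinear_form (trace_mul mu).
Proof.
by split=> *; rewrite /trace_mul !mulE ?right_mul_mxD ?right_mul_mxZ ?mxtraceD
  ?mxtraceZ.
Qed.

Lemma trace_comp_bilinear mu : bilinear_form (trace_comp mu).
Proof.
by split=> *; rewrite /trace_comp ?right_mul_mxD ?right_mul_mxZ
  ?(mulmxDl, mulmxDr) -?(scalemxAl, scalemxAr) ?mxtraceD ?mxtraceZ.
Qed.

Definition trace_mul_disc mu := \det (gram (trace_mul mu)).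

Definition trace_comp_disc mu := \det (gram (trace_comp mu)).

(** Gram determinants scale by the square of the base change; both discriminants have the same
    weight, so their ratio is invariant. *)
Lemma trace_mul_disc_act g mu : g \in unitmx ->
  trace_mul_disc (act g mu) = \det g ^- 2 * trace_mul_disc mu.
Proof.
move=> ug; rewrite /trace_mul_disc (gram_base_change (h := invmx g)
  (trace_mul_bilinear mu)).
  by rewrite !det_mulmx det_tr det_inv mulrAC -exprVn -expr2.
by move=> x y; rewrite trace_mul_act.
Qed.

Lemma trace_comp_disc_act g mu : g \in unitmx ->
  trace_comp_disc (act g mu) = \det g ^- 2 * trace_comp_disc mu.
Proof.
move=> ug; rewrite /trace_comp_disc (gram_base_change (h := invmx g)
  (trace_comp_bilinear mu)).
  by rewrite !det_mulmx det_tr det_inv mulrAC -exprVn -expr2.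
by move=> x y; rewrite trace_comp_act.
Qed.

Lemma regular_right_mul_mx T (X : set (T -> F)) (mu : T -> structure F)
    (y : T -> 'rV[F]_3) :
  regular_mx X mu -> regular_mx X y ->
  regular_mx X (fun t => right_mul_mx (mu t) (y t)).
Proof.
move=> rmu ry i j; apply: (@eq_regular _ _ _
  (fun t => mul (mu t) (delta_mx 0 i) (y t) 0 j)) => [t|]; first by rewrite
    [RHS]mxE.
by apply: regular_mul => //; apply: regular_mx_const.
Qed.

Lemma regular_trace_mul_disc : regular (@mx_coords F (3 * 3) 3) trace_mul_disc.
Proof.
apply: regular_det => i j; apply: (@eq_regular _ _ _
  (fun mu => trace_mul mu (delta_mx 0 i) (delta_mx 0 j))) => [t|].
  by rewrite [RHS]mxE.
apply: regular_trace; apply: regular_right_mul_mx; first exact: regular_id_mx.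
by apply: regular_mul; [apply: regular_id_mx|apply: regular_mx_const..].
Qed.

Lemma regular_trace_comp_disc : regular (@mx_coords F (3 * 3) 3)
  trace_comp_disc.
Proof.
apply: regular_det => i j; apply: (@eq_regular _ _ _
  (fun mu => trace_comp mu (delta_mx 0 i) (delta_mx 0 j))) => [t|].
  by rewrite [RHS]mxE.
by apply: regular_trace; apply: regular_mulmx; apply: regular_right_mul_mx;
  do ?[exact: regular_id_mx|exact: regular_mx_const].
Qed.

Lemma right_mul_mx_tab3 x11 x12 x13 x22 x23 x33 y (i j : 'I_3) :
  right_mul_mx (of_table (tab3 x11 x12 x13 x22 x23 x33)) y i j =
  y 0 0 * nth 0 [:: x11; x12; x13] i 0 j +
  y 0 1 * nth 0 [:: x12; x22; x23] i 0 j +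
  y 0 ord_max * nth 0 [:: x13; x23; x33] i 0 j.
Proof.
rewrite [LHS]mxE mul_tab3E; case: (ord3P i) => -> /=; rewrite !mxE /=; ring.
Qed.

Lemma trace_comp_disc_A01 (a b c : F) : trace_comp_disc (A01 a b c) = 2 * a * b.
Proof.
rewrite A01_tab3 /trace_comp_disc det_mx33.
have trE i j : gram (trace_comp (of_table (tab3 (e1 F) 0 (a *: e2 F) (e2 F)
    (b *: e1 F) (e1 F + c *: e2 F)))) i j =
    nth 0 (nth [::] [:: [:: 1; 0; 0]; [:: 0; 1; 0]; [:: 0; 0; 2 * a * b]] i) j.
  rewrite [LHS]mxE /trace_comp /mxtrace sum3 !mxE !sum3 !right_mul_mx_tab3 /=
    !mxE /=.
  by case: (ord3P i) => ->; case: (ord3P j) => -> /=; ring.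
rewrite !trE /=; ring.
Qed.

Lemma trace_mul_tab3 x11 x12 x13 x22 x23 x33 (i j : 'I_3) :
  let p := nth 0 (nth [::] [:: [:: x11; x12; x13]; [:: x12; x22; x23];
    [:: x13; x23; x33]] i) j in
  gram (trace_mul (of_table (tab3 x11 x12 x13 x22 x23 x33))) i j =
  p 0 0 * (x11 0 0 + x12 0 1 + x13 0 ord_max) +
  p 0 1 * (x12 0 0 + x22 0 1 + x23 0 ord_max) +
  p 0 ord_max * (x13 0 0 + x23 0 1 + x33 0 ord_max).
Proof.
move=> p; rewrite [LHS]mxE /trace_mul /mxtrace sum3 !right_mul_mx_tab3 /=.
have -> : mul (of_table (tab3 x11 x12 x13 x22 x23 x33)) (delta_mx 0 i)
  (delta_mx 0 j) = p.
  by rewrite mul_of_table /p; case: (ord3P i) => ->; case: (ord3P j) => ->.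
ring.
Qed.

Lemma trace_mul_disc_A01 (a b c : F) :
  trace_mul_disc (A01 a b c) = 1 + c - a ^+ 2 - b ^+ 2.
Proof.
rewrite A01_tab3 /trace_mul_disc det_mx33 !trace_mul_tab3 /= !mxE /=; ring.
Qed.

End Invariants.

(** * The open orbit, rigidity and the components *)

Section Orbits.
Variable F : numClosedFieldType.
Implicit Types (mu nu : structure F) (x y z u v w : 'rV[F]_3) (g h : 'M[F]_3).

(** The discriminant of the trace form of C[X]/(f) is the discriminant of f. *)
Lemma trace_mul_disc_cubic (r s t : F) : trace_mul_disc (cubic_structure r s
  t) =
  ((r - s) * (r - t) * (s - t)) ^+ 2.
Proof.
rewrite /trace_mul_disc det_mx33 !trace_mul_tab3 /= !mxE /=; ring.
Qed.

Lemma trace_mul_disc_split (s t : F) :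
  trace_mul_disc (split_structure s t) = (s * t) ^+ 2.
Proof.
rewrite /trace_mul_disc det_mx33 !trace_mul_tab3 /= !mxE /=; ring.
Qed.

Lemma trace_mul_disc_J07 : trace_mul_disc (J07 F) != 0.
Proof.
have [g /= ug gE] := split_structure_orbit (oner_neq0 F) (oner_neq0 F).
have := trace_mul_disc_act (J07 F) ug; rewrite gE trace_mul_disc_split mulr1
  expr1n.
by move/eqP; apply: contraTneq => ->; rewrite mulr0 oner_eq0.
Qed.

Definition ones : 'rV[F]_3 := const_mx 1.

Lemma det_right_mul_mx_J07 : \det (right_mul_mx (J07 F) ones) = 1.
Proof.
rewrite (_ : right_mul_mx _ _ = 1%:M) ?det1 //; apply/row_matrixP => i.
rewrite !rowE mul_right_mul_mx mulmx1; apply/rowP => k.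
by rewrite mul_J07 [ones _ _]mxE mulr1.
Qed.

Definition J07_complement : set (structure F) :=
  [set mu | trace_mul_disc mu = 0] `|`
  [set mu | forall y, \det (right_mul_mx mu y) = 0].

Lemma closed_J07_complement : zariski_closed J07_complement.
Proof.
apply: closedU; first exact: closed_hypersurface (regular_trace_mul_disc F).
apply: closed_family => y; apply: regular_det; apply: regular_right_mul_mx.
  exact: regular_id_mx.
exact: regular_mx_const.
Qed.

(** An invertible multiplication by [y] makes the products of the [e_i] with [y] a basis, so
    [A^2 = A] and the classification applies; a nonzero discriminant then excludes the degenerate
    normal forms. *)
Lemma orbit_J07E : orbit (J07 F) = @derived_comm_assoc F `\` J07_complement.
Proof.
apply/seteqP; split=> mu.
  move=> [g /= ug <-]; split.
    exact: derived_comm_assoc_act (J07_derived_comm_assoc F).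
  have d0 : \det g != 0 by rewrite -unitfE -unitmxE.
  case=> /=.
    rewrite trace_mul_disc_act // => /eqP; rewrite mulf_eq0 invr_eq0 expf_eq0
      /=.
    by rewrite (negPf d0) (negPf trace_mul_disc_J07).
  (* The image under [g] of the unit of [J07]. *)
  move=> /(_ (ones *m g)); rewrite det_right_mul_mx_act // mulmxK //.
  by rewrite det_right_mul_mx_J07 => /eqP; rewrite oner_eq0.
move=> [Lmu /not_orP [/eqP disc0 /existsNP [y /eqP dety]]].
have full : square_full mu.
  exists (e1 F), y, (e2 F), y, (e3 F), y; apply/basis3_unit.
  rewrite (_ : mx3 _ _ _ = right_mul_mx mu y) ?unitmxE ?unitfE //.
  apply/row_matrixP => i; rewrite !rowE delta3E mul_right_mul_mx.
  by case: (ord3P i) => ->.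
have [cmu _] := Lmu; have amu := square_full_assoc Lmu full.
case: (unital_classification cmu amu (unit_of_square_full cmu amu full)).
  move=> [g [r [s [t [ug muE]]]]]; rewrite muE; apply: orbit_act => //.
  move: disc0; rewrite muE trace_mul_disc_act // trace_mul_disc_cubic.
  rewrite mulf_eq0 sqrf_eq0 !mulf_eq0 !negb_or -!andbA !subr_eq0 => /and4P[_
    rs rt st].
  exact: cubic_structure_orbit.
move=> [g [s [t [ug muE]]]]; rewrite muE; apply: orbit_act => //.
move: disc0; rewrite muE trace_mul_disc_act // trace_mul_disc_split.
rewrite mulf_eq0 sqrf_eq0 !mulf_eq0 !negb_or => /and3P[_ s0 t0].
exact: split_structure_orbit.
Qed.

Lemma J07_rigid : rigid_in (@derived_comm_assoc F) (J07 F).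
Proof. by exists J07_complement; split; [apply: closed_J07_complement|apply:
  orbit_J07E]. Qed.

Lemma J07_notin_complement : ~ J07_complement (J07 F).
Proof. by have := orbit_refl (J07 F); rewrite orbit_J07E => -[]. Qed.

Lemma C2_det_right_mul_mx mu y : C2 mu -> \det (right_mul_mx mu y) = 0.
Proof.
move: mu; apply: (closure_min (Y := [set mu | \det (right_mul_mx mu y) = 0])).
  apply: closed_hypersurface; apply: regular_det; apply: regular_right_mul_mx.
    exact: regular_id_mx.
  exact: regular_mx_const.
move=> _ [a [b [c [g /= ug <-]]]]; rewrite det_right_mul_mx_act // A01_tab3
  det_mx33.
rewrite !right_mul_mx_tab3 /= !mxE /=; ring.
Qed.

Lemma C1_not_sub_C2 : ~ @C1 F `<=` @C2 F.
Proof.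
move=> /(_ _ (sub_closure (orbit_refl (J07 F)))) /(C2_det_right_mul_mx ones).
by rewrite det_right_mul_mx_J07 => /eqP; rewrite oner_eq0.
Qed.

Lemma A01_C2 (a b c : F) : C2 (A01 a b c).
Proof. by apply: sub_closure; exists a, b, c; apply: orbit_refl. Qed.

Lemma C1_assoc mu : C1 mu -> mul_assoc mu.
Proof.
move=> C1mu x y z; apply/rowP => k; apply/eqP; rewrite -subr_eq0; apply/eqP.
move: mu C1mu; apply: (closure_min (Y := [set mu : structure F |
    mul mu (mul mu x y) z 0 k - mul mu x (mul mu y z) 0 k = 0])).
  by apply: closed_hypersurface; apply: regularB;
    do !apply: regular_mul; do ?[exact: regular_id_mx|exact: regular_mx_const].
by move=> _ [g /= ug <-]; rewrite !mul_act !mulmxK // J07_assoc subrr.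
Qed.

Lemma C2_not_sub_C1 : ~ @C2 F `<=` @C1 F.
Proof.
(* Here [(e1 e1) e3 = e2] while [e1 (e1 e3) = e1 e2 = 0]. *)
move=> /(_ _ (A01_C2 1 0 0)) /C1_assoc /(_ (e1 F) (e1 F) (e3 F)).
rewrite A01_tab3 !mul_tab3 scale1r !mul_tab3 => /rowP /(_ 1).
by rewrite !mxE /= => /eqP; rewrite oner_eq0.
Qed.

(* The ratio of the two discriminants is GL(V)-invariant and not constant on  *)
(* the family A01, so that no orbit is dense in C2.                           *)
Lemma orbit_not_dense_C2 mu : ~ @C2 F `<=` zariski_closure (orbit mu).
Proof.
move=> dense; set p := trace_mul_disc mu; set q := trace_comp_disc mu.
have vanish f : regular (@mx_coords F (3 * 3) 3) f ->
    (forall nu, orbit mu nu -> f nu = 0) -> forall a b c, f (A01 a b c) = 0.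
  move=> rf f0 a b c; have := dense _ (A01_C2 a b c).
  by apply: (closure_min (Y := [set nu | f nu = 0])) => //; apply:
    closed_hypersurface.
have ratio a b c : q * (1 + c - a ^+ 2 - b ^+ 2) - p * (2 * a * b) = 0.
  rewrite -trace_mul_disc_A01 -(trace_comp_disc_A01 a b c).
  apply: (vanish (fun nu => q * trace_mul_disc nu - p * trace_comp_disc nu)).
    by apply: regularB; apply: regularZ;
      [apply: regular_trace_mul_disc|apply: regular_trace_comp_disc].
  move=> _ [g /= ug <-]; rewrite trace_mul_disc_act // trace_comp_disc_act //.
  by rewrite /p /q; ring.
(* At the origin the relation reads [q = 0]; then [trace_comp_disc] vanishes on the orbit of [mu],
   against its value 2 at [A01 1 1 0]. *)
have q0 : q = 0 by rewrite -[RHS](ratio 0 0 0); ring.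
have : trace_comp_disc (A01 1 1 0 : structure F) = 0.
  apply: vanish; first exact: regular_trace_comp_disc.
  by move=> _ [g /= ug <-]; rewrite trace_comp_disc_act // -/q q0 mulr0.
by move/eqP; rewrite trace_comp_disc_A01 !mulr1 pnatr_eq0.
Qed.

(** If the open orbit misses [C1], it meets the irreducible [C2] in a nonempty open set and is dense
    in it, which is impossible. Otherwise it meets the orbit of [J07], as nonempty open subsets of
    the irreducible [C1] intersect. *)
Lemma rigid_isomorphic nu : rigid_in (@derived_comm_assoc F) nu -> isomorphic
  nu (J07 F).
Proof.
move=> [Y [cY orbE]].
have [C1Y|nC1Y] := pselect (@C1 F `<=` Y).
  case: (@orbit_not_dense_C2 nu).
  have nuC2 : C2 nu /\ ~ Y nu.
    have : orbit nu nu by apply: orbit_refl.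
    by rewrite orbE derived_comm_assocU => -[[/C1Y|]].
  have [_ irr] := C2_irreducible F.
  case: (irr _ _ cY (closure_closed (orbit nu))) => // [mu C2mu|C2Y].
    have [Ymu|nYmu] := pselect (Y mu); [by left|right; apply: sub_closure].
    by rewrite orbE derived_comm_assocU; split=> //; right.
  by case: nuC2 => /C2Y.
apply: orbit_isomorphic; have [_ irr] := C1_irreducible F.
have [mu [/orbit_sym J07mu numu]] : exists mu, orbit (J07 F) mu /\ orbit nu mu.
  apply: contrapT => /forallNP disj.
  case: (irr _ _ cY closed_J07_complement) => [mu C1mu|//|].
    have [Ymu|nYmu] := pselect (Y mu); [by left|right].
    apply: contrapT => nJ; apply: (disj mu).
    by rewrite orbit_J07E orbE; split; split=> //; apply: C1_sub.
  by move=> /(_ _ (sub_closure (orbit_refl (J07 F)))) /J07_notin_complement.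
exact: orbit_trans numu J07mu.
Qed.

Lemma irreducible_components (Z : set (structure F)) :
  irreducible_component (@derived_comm_assoc F) Z <-> Z = @C1 F \/ Z = @C2 F.
Proof.
have cover Z' : irreducible Z' -> Z' `<=` @derived_comm_assoc F ->
    Z' `<=` @C1 F \/ Z' `<=` @C2 F.
  move=> [_ irr]; rewrite derived_comm_assocU.
  exact: irr (closure_closed _) (closure_closed _).
split=> [[irrZ ZL maxZ]|].
  case: (cover _ irrZ ZL) => ZC; [left|right]; symmetry; apply: maxZ => //.
  - exact: C1_irreducible.
  - exact: C1_sub.
  - exact: C2_irreducible.
  - exact: C2_sub.
case=> ->; split; do ?[exact: C1_irreducible|exact: C2_irreducible|
    exact: C1_sub|exact: C2_sub] => Z' irr Z'L CZ'.
  case: (cover _ irr Z'L) => Z'C; first by apply/seteqP.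
  by case: C1_not_sub_C2 => mu /CZ' /Z'C.
case: (cover _ irr Z'L) => Z'C; last by apply/seteqP.
by case: C2_not_sub_C1 => mu /CZ' /Z'C.
Qed.

End Orbits.

(** * A chain of length 12 *)

Section Chain.
Variable F : numClosedFieldType.
Implicit Types (mu nu : structure F) (v w : 'rV[F]_12).
Local Notation e1 := (e1 F).
Local Notation e2 := (e2 F).
Local Notation e3 := (e3 F).
Local Notation coords12 := (@mx_coords F 1 12).

Definition coord v (k : nat) : F := v 0 (inord k).
Arguments coord v k%_N.

(* Associativity on <e1, e2> says that a certain 3 x 2 matrix of structure    *)
(* constants has rank at most 1; coordinates 6 to 9 are a chart of this       *)
(* determinantal variety.                                                     *)
Definition plane_structure v : structure F :=
  of_table (tab3 ((coord v 9 * coord v 7 + coord v 6) *: e1 + coord v 7 *: e2)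
    (coord v 8 *: e1 + (coord v 9 * coord v 7) *: e2) (coord v 0 *: e1 + coord
      v 1 *: e2)
    ((coord v 9 * coord v 8) *: e1 + (coord v 8 - coord v 9 * coord v 6) *: e2)
    (coord v 2 *: e1 + coord v 3 *: e2) (coord v 4 *: e1 + coord v 5 *: e2)).

(** Moves the plane spanned by [e1], [e2]; its inverse is again a shear, so [chain_point] is
    polynomial. The 12 coordinates split into 4 for the product on the plane, 6 for products with
    [e3] and 2 for the position of the plane. *)
Definition shear (a b : F) := mx3 (e1 + a *: e3) (e2 + b *: e3) e3.

Definition chain_point v : structure F :=
  twist (shear (- coord v 10) (- coord v 11)) (shear (coord v 10) (coord v 11))
    (plane_structure v).

Lemma regular_coord k : regular coords12 (coord^~ k).
Proof. exact: regular_id_mx. Qed.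

Lemma regular_shear (a b : 'rV[F]_12 -> F) : regular coords12 a ->
  regular coords12 b ->
  regular_mx coords12 (fun v => shear (a v) (b v)).
Proof.
move=> ra rb i j; apply: (@eq_regular _ _ _ (fun v => nth 0 (nth [::]
    [:: [:: 1; 0; a v]; [:: 0; 1; b v]; [:: 0; 0; 1]] i) j)) => [v|].
  by case: (ord3P i) => ->; case: (ord3P j) => ->; rewrite !mxE /= ?mxE /=;
    ring.
by case: (ord3P i) => ->; case: (ord3P j) => -> /=;
  try exact: regular_const.
Qed.

Lemma regular_chain_point : regular_mx coords12 chain_point.
Proof.
have rc := regular_coord.
apply: regular_twist; try by apply: regular_shear; do ?apply: regularN.
have rz (f : 'rV[F]_12 -> F) x : regular coords12 f ->
    regular_mx coords12 (fun v => f v *: x : 'rV[F]_3).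
  by move=> rf; apply: regular_scalemx => //; apply: regular_mx_const.
have rM j k : regular coords12 (fun v => coord v j * coord v k).
  exact: regularM.
apply: regular_tab3; apply: regular_addmx; apply: rz => //.
  by apply: regularD.
by apply: regularB.
Qed.

Lemma shearM (a b : F) : shear (- a) (- b) *m shear a b = 1%:M.
Proof.
apply/matrixP => i j; rewrite [LHS]mxE sum3.
by case: (ord3P i) => ->; case: (ord3P j) => ->; rewrite !mxE /= ?mxE /=;
    ring.
Qed.

Lemma chain_point_derived_comm_assoc v : derived_comm_assoc (chain_point v).
Proof.
have := shearM (coord v 10) (coord v 11); set h := shear _ _; set g := shear _
  _ => hg.
have [_ ug] := mulmx1_unit hg.
have hE : h = invmx g by rewrite -[RHS]mul1mx -hg mulmxK.
have -> : chain_point v = act g (plane_structure v).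
  by apply: mulP => x y; rewrite mul_twist mul_act -/g -/h hE.
apply: derived_comm_assoc_act => //.
apply: (@derived_comm_assoc_span2 _ _ e1 e2).
- exact: tab3_comm.
- move=> x y; set p := mul _ x y; exists (p 0 0), (p 0 1).
  rewrite {1}[p]row3E (_ : p 0 ord_max = 0) ?scale0r ?addr0 //.
  by rewrite /p mul_tab3E !mxE /=; ring.
- by rewrite !mul_tab3 !mulE !mul_tab3; apply/rowP => k; rewrite !mxE; ring.
- by rewrite !mul_tab3 !mulE !mul_tab3; apply/rowP => k; rewrite !mxE; ring.
Qed.

Definition truncate (i : nat) v : 'rV[F]_12 :=
  \row_j (if (j < i)%N then v 0 j else 0).

Lemma coord_truncate i v k : (k < 12)%N ->
  coord (truncate i v) k = if (k < i)%N then coord v k else 0.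
Proof. by move=> ltk; rewrite /coord mxE inordK. Qed.

(** Irreducible as the closure of the image of a coordinate subspace; strict growth is witnessed by
    [separator i], which vanishes on stage [i] but not on stage [i.+1]. *)
Definition chain_stage i : set (structure F) :=
  zariski_closure (range (chain_point \o truncate i)).

Lemma regular_chain_stage i : regular_mx coords12 (chain_point \o truncate i).
Proof.
have rt : regular_mx coords12 (truncate i).
  move=> k j; rewrite ord1; apply: (@eq_regular _ _ _
    (fun v : 'rV_12 => if (j < i)%N then v 0 j else 0)) => [v|]; first by
      rewrite mxE.
  by case: (j < i)%N; [apply: regular_id_mx|apply: regular_const].
by move=> j k; apply: regular_mx_comp rt (regular_chain_point j k).
Qed.

Lemma chain_stage_irreducible i : irreducible (chain_stage i).
Proof.
pose d (v : 'rV[F]_12) : F := 1.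
have -> : chain_stage i = zariski_closure ((chain_point \o truncate i) @` [set
  v | d v != 0]).
  congr zariski_closure; apply/seteqP; split=> _ [v _ <-]; exists v => //.
  exact: oner_neq0.
apply: image_irreducible; first exact: regular_const.
  exact: regular_chain_stage.
by exists 0; apply: oner_neq0.
Qed.

Lemma chain_stage_sub i : chain_stage i `<=` @derived_comm_assoc F.
Proof.
apply: closure_min; first exact: closed_derived_comm_assoc.
by move=> _ [v _ <-]; apply: chain_point_derived_comm_assoc.
Qed.

Lemma chain_stageS i : chain_stage i `<=` chain_stage i.+1.
Proof.
apply: closureS => _ [v _ <-]; exists (truncate i v) => //=; congr chain_point.
apply/rowP => j; rewrite !mxE ltnS.
by case: (ltnP j i) => [/ltnW ->|_] //; rewrite if_same.
Qed.

Definition table_entry (i j k : 'I_3) mu := mul mu (delta_mx 0 i) (delta_mx 0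
  j) 0 k.

(** The default value of [nth] is separator 11. When coordinate 11 is zero, [e3 e3] and [e1 e3] lie
    in the plane spanned by [e1 + a e3] and [e2], so their first and last coordinates are
    proportional and this 2 x 2 minor vanishes. *)
Definition separator (i : nat) mu : F :=
  nth (table_entry ord_max ord_max ord_max mu * table_entry 0 ord_max 0 mu -
       table_entry 0 ord_max ord_max mu * table_entry ord_max ord_max 0 mu)
    [:: table_entry 0 ord_max 0 mu; table_entry 0 ord_max 1 mu;
        table_entry 1 ord_max 0 mu; table_entry 1 ord_max 1 mu;
        table_entry ord_max ord_max 0 mu; table_entry ord_max ord_max 1 mu;
        table_entry 0 0 0 mu; table_entry 0 0 1 mu; table_entry 0 1 0 mu;
        table_entry 0 1 1 mu; table_entry ord_max ord_max ord_max mu] i.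

Lemma regular_separator i : regular (@mx_coords F (3 * 3) 3) (separator i).
Proof.
have re j k l : regular (@mx_coords F (3 * 3) 3) (table_entry j k l).
  by apply: regular_mul; [apply: regular_id_mx|apply: regular_mx_const..].
do 11?[case: i => [|i]; first exact: re].
by apply: (@eq_regular _ _ _ (fun mu =>
  table_entry ord_max ord_max ord_max mu * table_entry 0 ord_max 0 mu -
  table_entry 0 ord_max ord_max mu * table_entry ord_max ord_max 0 mu)) =>
    [mu|];
  [rewrite /separator nth_default|apply: regularB; apply: regularM].
Qed.

Lemma table_entry_chain_point v :
  let x := coord v in let mu := chain_point v in
  [/\ [/\ table_entry ord_max ord_max 0 mu = x 4%N,
         table_entry ord_max ord_max 1 mu = x 5%N &
         table_entry ord_max ord_max ord_max mu =
           x 10%N * x 4%N + x 11%N * x 5%N],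
      [/\ table_entry 0 ord_max 0 mu = x 0%N - x 10%N * x 4%N,
         table_entry 0 ord_max 1 mu = x 1%N - x 10%N * x 5%N &
         table_entry 0 ord_max ord_max mu =
           x 10%N * (x 0%N - x 10%N * x 4%N) +
           x 11%N * (x 1%N - x 10%N * x 5%N)],
      x 10%N = 0 -> x 11%N = 0 ->
        table_entry 1 ord_max 0 mu = x 2%N /\
        table_entry 1 ord_max 1 mu = x 3%N &
      x 10%N = 0 -> x 11%N = 0 ->
        [/\ table_entry 0 0 0 mu = x 9%N * x 7%N + x 6%N,
           table_entry 0 0 1 mu = x 7%N, table_entry 0 1 0 mu = x 8%N &
           table_entry 0 1 1 mu = x 9%N * x 7%N]].
Proof.
rewrite /chain_point /plane_structure.
do 12!move: (coord v _) => ?.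
split; [split|split|move=> -> ->; split|move=> -> ->; split].
all: rewrite /table_entry mul_twist !delta3E /= ?mulE !mul_tab3 !mx3E !mxE /=.
all: ring.
Qed.

Lemma separator_truncate i v : (i < 12)%N -> separator i (chain_point
  (truncate i v)) = 0.
Proof.
have [[z0 z1 z2] [x0 x1 x2] y0 y1] := table_entry_chain_point (truncate i v).
move: z0 z1 z2 x0 x1 x2 y0 y1; rewrite !coord_truncate //.
do 12?[case: i => [|i]] => //= z0 z1 z2 x0 x1 x2 y0 y1 _.
all: try by have [p0 p1] := y0 erefl erefl; have [q0 q1 q2 q3] := y1 erefl
  erefl;
  rewrite /separator /= ?z0 ?z1 ?z2 ?x0 ?x1 ?x2 ?p0 ?p1 ?q0 ?q1 ?q2 ?q3; ring.
all: by rewrite /separator /= ?z0 ?z1 ?z2 ?x0 ?x1 ?x2; ring.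
Qed.

Lemma separator_point i : (i < 12)%N ->
  exists v, separator i (chain_point (truncate i.+1 v)) != 0.
Proof.
(* For each [i], the coordinates to set to 1 so that the separator takes the value 1; the last three
   separators reduce to the products [x7 x9], [x4 x10] and [x0 x5 x11]. *)
move=> lti; pose s := nth [:: i] [:: [:: 0]; [:: 1]; [:: 2]; [:: 3]; [:: 4];
  [:: 5]; [:: 6]; [:: 7]; [:: 8]; [:: 7; 9]; [:: 4; 10]; [:: 0; 5; 11]]%N i.
pose v : 'rV[F]_12 := \row_j (nat_of_ord j \in s)%:R; exists v.
have cv k : (k < 12)%N -> coord (truncate i.+1 v) k = ((k < i.+1) && (k \in
  s))%N%:R.
  by move=> ltk; rewrite coord_truncate // /coord mxE inordK //; case: ifP.
have [[z0 z1 z2] [x0 x1 x2] y0 y1] := table_entry_chain_point (truncate i.+1 v).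
move: z0 z1 z2 x0 x1 x2 y0 y1; rewrite !cv // /s.
move: (chain_point _) => mu {v cv s}.
do 12?[case: i lti => [|i] lti] => //= z0 z1 z2 x0 x1 x2 y0 y1.
all: try by have [p0 p1] := y0 erefl erefl; have [q0 q1 q2 q3] := y1 erefl
  erefl;
  rewrite /separator /= ?z0 ?z1 ?x0 ?x1 ?p0 ?p1 ?q0 ?q1 ?q2 ?q3
    ?(mulr0, mulr1, mul0r, subr0, addr0, add0r) oner_eq0.
all: by rewrite /separator /= ?z0 ?z1 ?z2 ?x0 ?x1 ?x2
  ?(mulr0, mulr1, mul0r, mul1r, subr0, addr0, add0r) oner_eq0.
Qed.


Lemma chain_stage_proper i : (i < 12)%N -> chain_stage i `<` chain_stage i.+1.
Proof.
move=> lti; split; first exact: chain_stageS.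
have [v sv] := separator_point lti.
have in_stage : chain_stage i.+1 (chain_point (truncate i.+1 v)).
  by apply: sub_closure; exists v.
move=> /(_ _ in_stage); suff sep0 mu : chain_stage i mu -> separator i mu = 0.
  by move=> /sep0 /eqP; rewrite (negPf sv).
apply: (closure_min (Y := [set mu | separator i mu = 0])).
  exact: closed_hypersurface (regular_separator i).
by move=> _ [w _ <-] /=; rewrite separator_truncate.
Qed.

Lemma dimension12 : has_dimension (@derived_comm_assoc F) 12.
Proof.
split; last exact: dimension_le12.
exists chain_stage; split; last exact: chain_stage_proper.
move=> i _; split; last exact: chain_stage_irreducible.
exists (chain_stage i); split; first exact: closure_closed.
by apply/esym/setIidPr; apply: chain_stage_sub.
Qed.

End Chain.

Theorem theoremG2 (R : realType) :
  let L : set (structure (complex R)) := @derived_comm_assoc (complex R) in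
  [/\ has_dimension L 12,
      forall Z : set (structure (complex R)),
        irreducible_component L Z <->
        Z = @C1 (complex R) \/ Z = @C2 (complex R),
      @C1 (complex R) <> @C2 (complex R) &
      exists mu : structure (complex R),
        rigid_in L mu /\
        forall nu : structure (complex R), rigid_in L nu -> isomorphic nu mu].
Proof.
move=> L; split.
- exact: dimension12.
- exact: irreducible_components.
- by move=> C12; apply: (@C1_not_sub_C2 (complex R)); rewrite C12.
- exists (J07 (complex R)); split; first exact: J07_rigid.
  exact: rigid_isomorphic.
Qed.
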